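(* Let $0<c<1$ and an integer $d\ge1$ be fixed, and for $N\ge 1$ let $\xi_N:S_N\to\{0,1\}$ be $$\xi_N:=\mathbb 1_{\{\pi\in S_N:\ \text{the length of the largest cycle in }\pi\text{ is at least }cN\}}.$$ Then the sequence of functions $\{\xi_{n^d}\}_{n=1}^\infty$ is noise sensitive with respect to the interchange process on the $d$-dimensional discrete torus $\mathbb T_n^d$.
   Context: $S_N$ is the group of permutations of $[N]=\{1,\dots,N\}$ under composition. The discrete torus $\mathbb T_n^d$ has vertex set $\mathbb Z_n^d$ ($\mathbb Z_n$ the integers modulo $n$) and edge set $\{\{x,y\}: x\neq y,\ x-y\in\{\pm e_1,\dots,\pm e_d\}\}$, where $e_j$ is the $j$th standard unit vector. Its $N=n^d$ vertices are labelled by $1,\dots,N$ (any fixed labelling), so that its edge set becomes a set $E$ of pairs $\{i,j\}\subset[N]$. The interchange process on this graph is the continuous-time Markov chain on $S_N$ with generator $(Qf)(\pi)=\nu\sum_{\{i,j\}\in E}\big(f(\pi\,(i,j))-f(\pi)\big)$, where $\nu>0$ is a constant rate. It is reversible and irreducible with uniform stationary distribution. Relaxation time: $t_{\rm rel}=1/\theta_1$, where $\theta_1$ is the smallest positive eigenvalue of $-Q$. A sequence $g_n:\Omega_n\to\{0,1\}$ is noise sensitive with respect to reversible irreducible continuous-time Markov chains $X_n(t)$ on finite sets $\Omega_n$ with stationary distributions $\pi_n$ and relaxation times $t^n_{\rm rel}$ if for all $\alpha>0$, $\lim_{n\to\infty}\mathrm{Cov}\big(g_n(X_n(0)),g_n(X_n(\alpha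 t^n_{\rm rel}))\big)=0$, where $X_n(0)\sim\pi_n$. Here $\Omega_n=S_{n^d}$ and $g_n=\xi_{n^d}$. *)

(* Defs.v *)
From HB Require Import structures.
From mathcomp Require Import all_boot all_order all_algebra all_fingroup.
From mathcomp Require Import all_classical all_reals all_analysis.

Set Implicit Arguments.
Unset Strict Implicit.
Unset Printing Implicit Defensive.

Import Order.TTheory GRing.Theory Num.Theory.
Import numFieldNormedType.Exports.

Local Open Scope classical_set_scope.
Local Open Scope ring_scope.

Section FiniteMarkovChains.
Context {R : realType} {Omega : finType}.

(* Generators are linear operators on the real functions on Omega. *)
Implicit Type Q : 'End({ffun Omega -> R^o}).

(* The matrix entry exp(t Q)(x, y) = (exp(t Q) 1_{y})(x), with
   exp(t Q) = \sum_k t^k / k! Q^k; compare expR, the limit of the same series. *)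
Definition transition_prob Q (t : R) (x y : Omega) : R :=
  let delta_y : {ffun Omega -> R^o} := [ffun z => (z == y)%:R] in
  limn (series (fun k => t ^+ k / k`!%:R * (iter k Q delta_y) x : R)).

(* The finite-dimensional distributions are those of the Markov chain with
   transition semigroup exp(t Q) and initial law mu; the values of X at
   negative times are irrelevant. *)
Definition markov_chain Q (mu : Omega -> R) {disp : measure_display}
    {T : measurableType disp} (P : probability T R)
    (X : R -> T -> Omega) : Prop :=
  (forall (t : R) (x : Omega), 0 <= t -> measurable (X t @^-1` [set x])) /\
  (forall (k : nat) (t : nat -> R) (x : nat -> Omega),
     t 0%N = 0 -> (forall i, (i < k)%N -> t i <= t i.+1) ->
     P [set w | forall i, (i <= k)%N -> X (t i) w = x i] =
     (mu (x 0%N) *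
      \prod_(i < k) transition_prob Q (t i.+1 - t i) (x i) (x i.+1))%:E).

Definition smallest_pos_eigenvalue Q (theta : R) : Prop :=
  [/\ 0 < theta, passmx.leigenvalue Q theta
    & forall theta', 0 < theta' -> passmx.leigenvalue Q theta' -> theta <= theta'].

(* The smallest positive eigenvalue of -Q is unique when it exists; the
   default 0 is only used when -Q has no positive eigenvalue, for instance
   for the chain on a one-point space. *)
Definition relaxation_time Q : R :=
  (xget 0 [set theta | smallest_pos_eigenvalue (- Q) theta])^-1.

End FiniteMarkovChains.

(* The covariance depends only on the law of the chain, so the realization of
   the n-th chain on a probability space is arbitrary. *)
Definition noise_sensitive (R : realType) (Omega : nat -> finType)
    (Q : forall n, 'End({ffun Omega n -> R^o})) (mu : forall n, Omega n -> R)
    (g : forall n, Omega n -> bool) : Prop :=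
  forall (disp : nat -> measure_display)
    (T : forall n, measurableType (disp n))
    (P : forall n, probability (T n) R)
    (X : forall n, R -> T n -> Omega n),
  (forall n, markov_chain (Q n) (mu n) (P n) (X n)) ->
  forall alpha : R, 0 < alpha ->
  (fun n => covariance (P n)
     (fun w => (g n (X n 0 w))%:R)
     (fun w => (g n (X n (alpha * relaxation_time (Q n)) w))%:R))
  @ \oo --> 0%E.

Definition uniform_distribution {R : realType} {Omega : finType} : Omega -> R :=
  fun _ => #|Omega|%:R^-1.

Section Interchange.
Context {R : realType} {N : nat}.

(* An edge {i, j} is counted once, as the pair with i < j. The permutation
   pi (i,j) composed as functions, which applies (i,j) first, is
   tperm i j * pi since MathComp's product of permutations composes from left
   to right. *)
Definition interchange_op (nu : R) (E : {set {set 'I_N}}) (f : 'S_N -> R)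
    (pi : 'S_N) : R :=
  nu * \sum_(i < N) \sum_(j < N | (i < j)%N && ([set i; j]%SET \in E))
         (f (tperm i j * pi)%g - f pi).

Definition interchange_fun (nu : R) (E : {set {set 'I_N}})
    (f : {ffun 'S_N -> R^o}) : {ffun 'S_N -> R^o} :=
  [ffun pi => interchange_op nu E f pi].

Lemma interchange_op_linear nu E a (f h : 'S_N -> R) pi :
  interchange_op nu E (fun s => a * f s + h s) pi =
  a * interchange_op nu E f pi + interchange_op nu E h pi.
Proof.
rewrite /interchange_op mulrCA -mulrDr; congr (_ * _).
rewrite mulr_sumr -big_split; apply: eq_bigr => i _ /=.
rewrite mulr_sumr -big_split; apply: eq_bigr => j _ /=.
by rewrite mulrBr opprD addrACA.
Qed.

Lemma interchange_fun_linear nu E : linear (interchange_fun nu E).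
Proof.
move=> a f h; apply/ffunP => s; rewrite !ffunE.
rewrite -[RHS]interchange_op_linear; congr interchange_op.
by apply/funext => t; rewrite !ffunE.
Qed.

HB.instance Definition _ nu E :=
  GRing.isLinear.Build R {ffun 'S_N -> R^o} {ffun 'S_N -> R^o} *:%R
    (interchange_fun nu E) (interchange_fun_linear nu E).

Definition interchange_generator (nu : R) (E : {set {set 'I_N}}) :
  'End({ffun 'S_N -> R^o}) := linfun (interchange_fun nu E).

End Interchange.

(* 'I_n.+1 carries the group structure of the integers modulo n.+1 for every n,
   including the trivial group for n = 0. *)
Definition torus (d n : nat) : finType := {ffun 'I_d -> 'I_n.+1}.

Section Torus.
Context {d n : nat}.
Implicit Types x y : {ffun 'I_d -> 'I_n.+1}.

Definition unit_vector (j : 'I_d) : {ffun 'I_d -> 'I_n.+1} :=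
  [ffun k => if k == j then inZp 1 else 0].

Definition torus_adj x y : bool :=
  (x != y) &&
  [exists j, (x - y == unit_vector j) || (x - y == - unit_vector j)].

Definition torus_edges (lab : torus d n -> 'I_(n.+1 ^ d)) :
    {set {set 'I_(n.+1 ^ d)}} :=
  [set [set lab u.1; lab u.2]%SET
    | u in [set u : torus d n * torus d n | torus_adj u.1 u.2]%SET]%SET.

End Torus.

Definition longest_cycle (N : nat) (s : 'S_N) : nat :=
  \max_(C in porbits s) #|C|.

Definition xi (R : realType) (c : R) (N : nat) (s : 'S_N) : bool :=
  c * N%:R <= (longest_cycle s)%:R.

(* Main.v *)
Require Import Defs.
From HB Require Import structures.
From mathcomp Require Import all_boot all_order all_algebra all_fingroup.
From mathcomp Require Import all_classical all_reals all_analysis.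
From mathcomp Require complex.
From mathcomp Require Import ring lra zify.

Set Implicit Arguments.
Unset Strict Implicit.
Unset Printing Implicit Defensive.

Import Order.TTheory GRing.Theory Num.Theory.
Import numFieldNormedType.Exports.

Local Open Scope classical_set_scope.
Local Open Scope ring_scope.

(**
Write X for a uniform permutation, xi for the indicator in question, and for a
set A of points let H be the group Sym A of the permutations supported in A.

Slowness. The position of a single card performs a random walk on the torus, so
cos (2 pi y / L), with y its first coordinate and L the side length, gives an
eigenfunction of the interchange process with eigenvalue nu (2 - 2 cos (2 pi / L))
(torus_relaxation_time_ge). Hence the relaxation time tends to infinity, and so
do the times t = alpha t_rel at which the chain is observed.

Local equilibrium. Let A be a path of B consecutive points on a line of the
torus, B being fixed. The Dirichlet form dominates that of the process which
only uses the edges of this path, and the latter has a spectral gap gamma > 0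
depending on B alone, with the H-invariant functions as kernel (path_poincare).
A variational argument with the resolvent (heat_form_poincare) then gives, for
f = xi - E xi and P the average over the cosets of H,
  Cov(xi(X_0), xi(X_t)) <= ||P f||^2 + 1 / (1 + t gamma),
and the last term tends to 0. It remains to see that xi is nearly independent
of the coset of X.

Decoupling. The permutation induced by X on A (its first-return map) has as
cycles the traces C :&: A of the cycles C of X. Composing X with h in H composes
the induced permutation with h, so on each coset of H the induced permutation
is uniform on Sym A (induced_perm). Let xi_trace be the indicator that some
trace has at least c B points. Its average over a coset is therefore the same
for all cosets (coset_avg_trace), and ||P f||^2 is at most the probability that
xi and xi_trace differ (coset_avg_centered_xi).

Sampling. The events differ only if some cycle has a length close to c N, or if
some cycle C has |C :&: A| / B far from |C| / N (xi_trace_approx). The length of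
the cycle of a given point is uniform, so the first case is rare
(cycle_window_bound). For the second, the sum over C of the squared deviations
is a quadratic form in weights of total mass 0, whose mean is at most 1 / B
because all pairs of distinct points are equally likely to share a cycle
(sum_cycle_discrepancy). Both errors vanish as N and then B tend to infinity.
*)

(** * Spectral decomposition of real symmetric matrices *)

Section RealSpectral.
Import complex.

(** The real and imaginary parts of the rows of a unitary matrix diagonalizing A
    are again eigenvectors, the eigenvalues being real; taken together they need
    not be orthogonal but still resolve the identity, which is all that spectral
    calculus needs. *)
Lemma real_spectral (R : rcfType) n (A : 'M[R]_n) : A^T = A ->
  exists (th : ('I_n * bool)%type -> R) (v : ('I_n * bool)%type -> 'rV[R]_n),
    (forall i k, \sum_j v i 0 j * A j k = th i * v i 0 k) /\
    (forall j k, \sum_i v i 0 j * v i 0 k = (j == k)%:R).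
Proof.
move=> symA.
pose C : numClosedFieldType := complex.complex R.
pose toC : R -> C := complex.real_complex_def (Phant R).
pose AC : 'M[C]_n := map_mx toC A.
have hermA : AC \is hermsymmx.
  apply: realsym_hermsym.
    by apply/is_hermitianmxP; rewrite expr0 scale1r map_mx_id // map_trmx symA.
  apply/mxOverP => i j; rewrite mxE; apply/complex.complex_realP; by exists (A i j).
have /hermitian_normalmx/orthomx_spectralP AE := hermA.
have /mxOverP dreal := hermitian_spectral_diag_real hermA.
have uU := spectral_unitarymx AC.
move: AE dreal uU; set U := spectralmx AC; set d := spectral_diag AC.
move=> AE dreal uU.
have UA : U *m AC = diag_mx d *m U.
  by rewrite {1}AE mulmxA mulmxA mulmxV ?mul1mx // unitarymx_unit.
have UU : invmx U *m U = 1%:M by rewrite mulVmx // unitarymx_unit.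
rewrite invmx_unitary // in UU.
exists (fun ib => complex.Re (d 0 ib.1)).
exists (fun ib => \row_j (if ib.2 then complex.Re (U ib.1 j) else complex.Im (U ib.1 j))).
have ReS (I : finType) (F : I -> complex.complex R) :
    complex.Re (\sum_i F i) = \sum_i complex.Re (F i).
  by apply: (big_morph (@complex.Re R)) => // -[a b] [a' b'].
have ImS (I : finType) (F : I -> complex.complex R) :
    complex.Im (\sum_i F i) = \sum_i complex.Im (F i).
  by apply: (big_morph (@complex.Im R)) => // -[a b] [a' b'].
split.
  case=> i b k.
  have /matrixP/(_ i k) := UA.
  rewrite mul_diag_mx !mxE => E.
  have /complex.complex_realP [r dr] := dreal 0 i.
  rewrite dr in E *.
  case: b => /=.
    move/(congr1 (@complex.Re R)): E.
    rewrite ReS; case: (U i k) => u u' /=; rewrite mul0r subr0 => <-.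
    apply: eq_bigr => j _; rewrite !mxE; case: (U i j) => w w' /=.
    by rewrite mulr0 subr0.
  move/(congr1 (@complex.Im R)): E.
  rewrite ImS; case: (U i k) => u u' /=; rewrite mul0r addr0 => <-.
  apply: eq_bigr => j _; rewrite !mxE; case: (U i j) => w w' /=.
  by rewrite mulr0 add0r.
move=> j k.
have /matrixP/(_ j k) := UU.
rewrite !mxE => /(congr1 (@complex.Re R)); rewrite ReS.
have -> : complex.Re ((j == k)%:R : complex.complex R) = (j == k)%:R by case: (j == k).
move=> <-.
pose part (b : bool) (z : C) := if b then complex.Re z else complex.Im z.
rewrite (eq_bigr (fun ib => (fun i b => part b (U i j) * part b (U i k)) ib.1 ib.2));
  last by case=> i b _; rewrite !mxE.
rewrite -(pair_bigA _ (fun i b => part b (U i j) * part b (U i k))) /=.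
apply: eq_bigr => i _; rewrite big_bool /= !mxE.
case: (U i j) => a b; case: (U i k) => a' b' /=.
by rewrite mulNr opprK.
Qed.

End RealSpectral.

(** * Self-adjoint generators and their semigroups *)

Section SymmetricGenerators.
Context {R : realType} {Omega : finType}.
Notation V := {ffun Omega -> R^o}.
Implicit Types (f g : V) (Q : 'End(V)).

Definition dot f g : R := \sum_x (f x : R) * g x.

Lemma dotC f g : dot f g = dot g f.
Proof. by apply: eq_bigr => x _; rewrite mulrC. Qed.

Lemma dotDl f f' g : dot (f + f') g = dot f g + dot f' g.
Proof. by rewrite -big_split; apply: eq_bigr => x _; rewrite !ffunE mulrDl. Qed.

Lemma dotZl a f g : dot (a *: f) g = a * dot f g.
Proof. by rewrite mulr_sumr; apply: eq_bigr => x _; rewrite !ffunE mulrA. Qed.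

Lemma dotNl f g : dot (- f) g = - dot f g.
Proof. by rewrite -scaleN1r dotZl mulN1r. Qed.

Lemma dotDr f g g' : dot f (g + g') = dot f g + dot f g'.
Proof. by rewrite dotC dotDl !(dotC f). Qed.

Lemma dotZr a f g : dot f (a *: g) = a * dot f g.
Proof. by rewrite dotC dotZl dotC. Qed.

Lemma dotNr f g : dot f (- g) = - dot f g.
Proof. by rewrite dotC dotNl dotC. Qed.

Lemma dot_suml (I : finType) (F : I -> V) g :
  dot (\sum_i F i) g = \sum_i dot (F i) g.
Proof.
rewrite /dot exchange_big /=; apply: eq_bigr => x _.
by rewrite sum_ffunE mulr_suml.
Qed.

Lemma dot_ge0 f : 0 <= dot f f.
Proof. by apply: sumr_ge0 => x _; rewrite -expr2 sqr_ge0. Qed.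

Definition self_adjoint Q := forall f g, dot (Q f) g = dot f (Q g).

Definition point_mass (y : Omega) : V := [ffun z => (z == y)%:R].

Lemma dot_point_mass f y : dot f (point_mass y) = f y.
Proof.
rewrite /dot (bigD1 y) //= ffunE eqxx mulr1 big1 ?addr0 // => x /negbTE xy.
by rewrite ffunE xy mulr0.
Qed.

Lemma ffun_point_mass f : f = \sum_y f y *: point_mass y.
Proof.
apply/ffunP => x; rewrite sum_ffunE (bigD1 x) //= big1 ?addr0.
  by rewrite !ffunE eqxx /GRing.scale /= mulr1.
by move=> y yx; rewrite !ffunE eq_sym (negbTE yx) scaler0.
Qed.

Lemma spectral_decomposition Q : self_adjoint Q ->
  exists (I : finType) (th : I -> R) (v : I -> V),
    (forall i, Q (v i) = th i *: v i) /\ (forall f, f = \sum_i dot f (v i) *: v i).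
Proof.
move=> symQ.
pose A : 'M[R]_#|Omega| :=
  \matrix_(j, k) Q (point_mass (enum_val j)) (enum_val k).
have symA : A^T = A.
  by apply/matrixP => j k; rewrite !mxE -!dot_point_mass symQ dotC.
have [th [v [Av vv]]] := real_spectral symA.
pose w i : V := [ffun x => v i 0 (enum_rank x)].
exists ('I_#|Omega| * bool)%type, th, w; split => [i|f].
  apply/ffunP => x; rewrite {1}[w i]ffun_point_mass linear_sum sum_ffunE.
  rewrite !ffunE -[RHS]Av.
  rewrite (reindex_onto enum_val enum_rank) /= => [|y _]; last exact: enum_rankK.
  rewrite (eq_bigl xpredT) => [|j]; last by rewrite enum_valK eqxx.
  apply: eq_bigr => j _.
  by rewrite linearZ !ffunE enum_valK /= !mxE enum_rankK.
apply/ffunP => x; rewrite sum_ffunE.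
transitivity (\sum_y (f y : R) * (y == x)%:R).
  rewrite (bigD1 x) //= eqxx mulr1 big1 ?addr0 // => y /negbTE ->.
  by rewrite mulr0.
under [RHS]eq_bigr do rewrite ffunE /GRing.scale /= mulr_suml.
rewrite exchange_big /=; apply: eq_bigr => y _.
rewrite -(inj_eq enum_rank_inj) -vv mulr_sumr.
by apply: eq_bigr => i _; rewrite !ffunE mulrA.
Qed.

Section Heat.
Context (Q : 'End(V)) (I : finType) (th : I -> R) (v : I -> V).
Hypothesis eig : forall i, Q (v i) = th i *: v i.
Hypothesis dec : forall f, f = \sum_i dot f (v i) *: v i.

Lemma iter_spectral k f : iter k Q f = \sum_i (th i ^+ k * dot f (v i)) *: v i.
Proof.
elim: k => [|k IH] /=.
  by rewrite [LHS]dec; apply: eq_bigr => i _; rewrite expr0 mul1r.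
rewrite IH linear_sum; apply: eq_bigr => i _.
by rewrite linearZ /= eig scalerA exprSr -!mulrA [dot _ _ * _]mulrC.
Qed.

Lemma transition_prob_spectral t x y :
  transition_prob Q t x y = \sum_i expR (t * th i) * ((v i x : R) * v i y).
Proof.
apply: cvg_lim => //.
have -> : series (fun k => t ^+ k / k`!%:R * (iter k Q (point_mass y)) x : R) =
   (fun n => \sum_i series (exp_coeff (t * th i)) n * ((v i x : R) * v i y)).
  apply/funext => n; rewrite /series /=.
  under [RHS]eq_bigr do rewrite mulr_suml.
  rewrite exchange_big /=; apply: eq_bigr => k _.
  rewrite iter_spectral sum_ffunE mulr_sumr; apply: eq_bigr => i _.
  rewrite !ffunE dotC dot_point_mass /exp_coeff /= exprMn /GRing.scale /=.
  by ring.
apply: cvg_big => [|i _]; first exact: add_continuous.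
by apply: cvgMr_tmp; apply: is_cvg_series_exp_coeff.
Qed.


(** By exp(-u) <= 1 / (1 + u) the semigroup is dominated by the resolvent of Q,
    and unlike the former the latter has a variational description: g below is
    the resolvent applied to f. *)
Lemma heat_form_le_resolvent (t : R) f : 0 <= t -> (forall g, dot (Q g) g <= 0) ->
  exists g, f = g - t *: Q g /\
    0 <= \sum_x \sum_y (f x : R) * f y * transition_prob Q t x y <= dot f g.
Proof.
move=> t0 Qneg.
(* An eigenvector v i may vanish, and then th i is arbitrary. *)
have thneg i : dot f (v i) = 0 :> R \/ th i <= 0.
  have [v0|v0] := eqVneq (dot (v i) (v i)) (0 : R).
    left; rewrite /dot big1 // => x _.
    have /eqP := v0; rewrite psumr_eq0 => [|y _]; last by rewrite -expr2 sqr_ge0.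
    move=> /allP/(_ x (mem_index_enum _))/=; rewrite mulf_eq0 orbb => /eqP ->.
    by rewrite mulr0.
  right; have := Qneg (v i); rewrite eig dotZl pmulr_lle0 // lt_neqAle eq_sym v0.
  exact: dot_ge0.
(* The coefficients of the resolvent in the eigenvectors. *)
pose r i := (1 - t * th i)^-1.
exists (\sum_i (r i * dot f (v i)) *: v i); split.
  rewrite linear_sum /= scaler_sumr -sumrB [LHS]dec; apply: eq_bigr => i _.
  rewrite [Q (_ *: _)]linearZ /= eig !scalerA -scalerBl; congr (_ *: _).
  have [->|thi] := thneg i; first by rewrite !(mulr0, mul0r) subrr.
  rewrite /r; field; apply: lt0r_neq0; rewrite subr_gt0.
  by apply: le_lt_trans ltr01; rewrite mulr_ge0_le0.
have -> : \sum_x \sum_y (f x : R) * f y * transition_prob Q t x y =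
    \sum_i expR (t * th i) * dot f (v i) ^+ 2.
  under eq_bigr do under eq_bigr do
    rewrite transition_prob_spectral mulr_sumr.
  under eq_bigr do rewrite exchange_big /=.
  rewrite exchange_big /=; apply: eq_bigr => i _.
  rewrite expr2 {1}/dot mulr_suml mulr_sumr; apply: eq_bigr => x _.
  rewrite /dot mulr_sumr mulr_sumr; apply: eq_bigr => y _.
  by ring.
rewrite sumr_ge0 /= => [|i _]; last by rewrite mulr_ge0 ?expR_ge0 ?sqr_ge0.
rewrite dotC dot_suml; apply: ler_sum => i _.
rewrite dotZl [dot (v i) f]dotC -mulrA -expr2.
have [->|thi] := thneg i; first by rewrite expr0n /= !mulr0.
apply: ler_wpM2r; first exact: sqr_ge0.
rewrite -[t * th i]opprK expRN lef_pV2 ?posrE ?expR_gt0 //.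
  exact: expR_ge1Dx.
rewrite subr_gt0.
by apply: le_lt_trans ltr01; rewrite mulr_ge0_le0.
Qed.

End Heat.
End SymmetricGenerators.

(** * Poincare inequalities, relaxation time and covariance *)

Section Chains.
Context {R : realType} {Omega : finType}.
Notation V := {ffun Omega -> R^o}.
Implicit Types (f g : V) (Q : 'End(V)).

(** The resolvent form of f is the maximum over g of
    2 <f, g> - <g, g> + t <Q g, g>. Bounding the Dirichlet form from below by
    the Poincare inequality decouples P g from g - P g, and each part of the
    maximum is then explicit. *)
Lemma heat_form_poincare Q (P : {linear V -> V}) (gamma t : R) f :
  self_adjoint Q -> (forall g, dot (Q g) g <= 0) ->
  (forall g h, dot (P g) h = dot g (P h)) -> (forall g, P (P g) = P g) ->
  0 <= gamma -> 0 <= t ->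
  (forall g, gamma * dot (g - P g) (g - P g) <= - dot (Q g) g) ->
  0 <= \sum_x \sum_y (f x : R) * f y * transition_prob Q t x y <=
  dot (P f) (P f) + dot f f / (1 + t * gamma).
Proof.
move=> symQ negQ symP idemP ga0 t0 poin.
have [I [th [v [eig dec]]]] := spectral_decomposition symQ.
have [g [fE /andP[-> /le_trans]]] := heat_form_le_resolvent eig dec f t0 negQ.
apply.
have split f' g' : dot f' g' = dot (P f') (P g') + dot (f' - P f') (g' - P g').
  rewrite !(dotDl, dotDr, dotNl, dotNr) !symP !idemP.
  by ring.
have [K0 K1] : 0 < 1 + t * gamma /\ 1 <= 1 + t * gamma.
  by rewrite lerDl ltr_wpDr ?mulr_ge0.
have H1 : dot (P g) (P g) + (1 + t * gamma) * dot (g - P g) (g - P g) <= dot f g.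
  have -> : dot f g = dot g g - t * dot (Q g) g.
    by rewrite [in LHS]fE dotDl dotNl dotZl.
  rewrite (split g g) mulrDl mul1r addrA lerD2l.
  by rewrite -mulrN -mulrA ler_wpM2l.
(* Completing the squares in the two orthogonal components. *)
have H2 : 0 <= dot (P f - P g) (P f - P g) by exact: dot_ge0.
have H3 : 0 <= dot (f - P f - (1 + t * gamma) *: (g - P g))
                   (f - P f - (1 + t * gamma) *: (g - P g)) by exact: dot_ge0.
have H4 := dot_ge0 (P f).
have := split f g; have := split f f.
move: H1 H2 H3 K0 K1; set K := 1 + _ => H1 H2 H3 K0 K1; move: H1 H2 H3.
set c := f - P f; set e := g - P g; clearbody K c e; move: (P f) (P g) H4 => a b.
rewrite !(dotDl c, dotDl a, dotDr, dotNl, dotNr, dotZl, dotZr) (dotC e) (dotC b).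
move=> H4 H1 H2 H3 Eff Efg.
suff : K * (dot f g - dot a a) <= dot f f.
  by rewrite mulrC -ler_pdivlMr // lerBlDl.
have KK : K * (dot b b + K * dot e e) <= K * dot f g by rewrite ler_pM2l.
have KH2 : 0 <= K * (dot a a - dot a b - (dot a b - dot b b)).
  apply: mulr_ge0; first exact: ltW.
  by move: H2; lra.
move: KK KH2 H3; rewrite Eff Efg; nra.
Qed.

Lemma leigenvalueP (phi : 'End(V)) (a : R) :
  reflect (exists2 g, g != 0 & phi g = a *: g) (passmx.leigenvalue phi a).
Proof.
have E g : (g \in passmx.leigenspace phi a) = (phi g == a *: g).
  by rewrite memv_ker add_lfunE opp_lfunE scale_lfunE id_lfunE subr_eq0.
apply: (iffP idP) => [n0|[g g0 /eqP]].
  exists (vpick (passmx.leigenspace phi a)); first by rewrite vpick0.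
  by apply/eqP; rewrite -E memv_pick.
rewrite -E => gin; apply: contraNneq g0 => S0.
by move: gin; rewrite S0 memv0.
Qed.

(** Every eigenvalue of Q occurs in a spectral decomposition, so there are
    finitely many and the smallest positive eigenvalue of -Q is attained as
    soon as there is a positive one. *)
Lemma relaxation_time_ge Q (lam : R) g : self_adjoint Q ->
  0 < lam -> g != 0 -> (- Q) g = lam *: g -> lam^-1 <= relaxation_time Q.
Proof.
move=> symQ lam0 g0 gE.
have [I [th [v [eig dec]]]] := spectral_decomposition symQ.
have spec a h : h != 0 -> (- Q) h = a *: h -> exists i, a = - th i.
  move=> h0 hE.
  have [i hi] : exists i, dot h (v i) != 0.
    apply/existsP; apply: contra_neqT h0 => /existsPn h0.
    rewrite [h]dec big1 // => i _; have /negPn/eqP -> := h0 i.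
    by rewrite scale0r.
  exists i; have : dot ((- Q) h) (v i) = - th i * dot h (v i).
    by rewrite opp_lfunE dotNl symQ eig dotZr mulNr.
  by rewrite hE dotZl => /(mulIf hi).
have [i0 i0E] := spec _ _ g0 gE.
pose good i := (0 < - th i) && passmx.leigenvalue (- Q) (- th i).
have good0 : good i0.
  by rewrite /good -i0E lam0; apply/leigenvalueP; exists g.
rewrite /relaxation_time.
case: (arg_minP (fun i => - th i) good0) => i /andP[thi evi] imin.
have : smallest_pos_eigenvalue (- Q)
    (xget 0 [set theta | smallest_pos_eigenvalue (- Q) theta]).
  apply: (@xgetPex _ 0 [set theta | smallest_pos_eigenvalue (- Q) theta]).
  exists (- th i); split => // th' th'0 ev'.
  have /leigenvalueP[h h0 hE] := ev'.
  have [j jE] := spec _ _ h0 hE.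
  by rewrite jE; apply: imin; rewrite /good -jE th'0.
move: (xget _ _) => theta [theta0 _ min].
have lam_pos : lam \is Num.pos by exact: lam0.
have theta_pos : theta \is Num.pos by exact: theta0.
rewrite (lef_pV2 lam_pos theta_pos); apply: (min lam lam0).
by apply/leigenvalueP; exists g.
Qed.

Lemma transition_prob_sym Q t x y : self_adjoint Q ->
  transition_prob Q t x y = transition_prob Q t y x.
Proof.
move=> /spectral_decomposition[I [th [v [eig dec]]]].
rewrite !(transition_prob_spectral eig dec).
by apply: eq_bigr => i _; rewrite [(_ : R) * v i y]mulrC.
Qed.

(** Constants are harmonic, so they are orthogonal to the eigenvectors of
    nonzero eigenvalue. *)
Lemma transition_prob_sum1 Q t x : self_adjoint Q -> Q [ffun=> 1] = 0 ->
  \sum_y transition_prob Q t x y = 1.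
Proof.
move=> symQ Q1; have [I [th [v [eig dec]]]] := spectral_decomposition symQ.
under eq_bigr do rewrite (transition_prob_spectral eig dec).
rewrite exchange_big /=.
have /ffunP/(_ x) := dec [ffun=> 1]; rewrite ffunE sum_ffunE => ->.
apply: eq_bigr => i _; rewrite ffunE.
have dE : dot [ffun=> 1] (v i) = \sum_y (v i y : R).
  by apply: eq_bigr => y _; rewrite ffunE mul1r.
have : th i * dot [ffun=> 1] (v i) = 0.
  by rewrite -dotZr -eig -symQ Q1 /dot big1 // => y _; rewrite ffunE mul0r.
rewrite -!mulr_sumr -dE => /eqP; rewrite mulf_eq0 => /orP[/eqP ->|/eqP ->].
  by rewrite mulr0 expR0 mul1r /GRing.scale /= mulrC.
by rewrite scale0r !mulr0.
Qed.

End Chains.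

Section Covariance.
Local Open Scope ereal_scope.

Lemma expectation_finite (R : realType) (S : finType) (d : measure_display)
    (T : measurableType d) (P : probability T R) (Z : T -> S) (p : S -> R)
    (F : S -> R) :
  (forall z, measurable (Z @^-1` [set z])) ->
  (forall z, P (Z @^-1` [set z]) = (p z)%:E) ->
  expectation P (fun w => F (Z w)) = (\sum_z F z * p z)%R%:E.
Proof.
move=> mZ PZ; rewrite unlock.
transitivity (\int[P]_w \sum_(z : S) ((F z)%:E * (\1_(Z @^-1` [set z]) w)%:E)).
  apply: eq_integral => w _; rewrite (bigD1 (Z w)) //= big1 ?adde0.
    by rewrite indicE mem_set //= mule1.
  move=> z zw; rewrite indicE memNset ?mule0 //= => wz.
  by rewrite wz eqxx in zw.
rewrite integral_sum //= => [|z]; last first.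
  by apply: integrableZl => //; apply: integrable_indic.
rewrite -sumEFin; apply: eq_bigr => z _.
rewrite integralZl //=; last exact: integrable_indic.
by rewrite integral_indic // setIT EFinM -PZ.
Qed.

(** Symmetry of Q makes the uniform law stationary, so both marginals have
    mean m. *)
Lemma covariance_chain (R : realType) (Omega : finType)
    (Q : 'End({ffun Omega -> R^o})) (d : measure_display) (T : measurableType d)
    (P : probability T R) (X : R -> T -> Omega) (t : R) (f : Omega -> R) :
  self_adjoint Q -> Q [ffun=> 1%R] = 0%R ->
  markov_chain Q uniform_distribution P X -> (0 <= t)%R ->
  let m := (#|Omega|%:R^-1 * \sum_x f x)%R in
  covariance P (fun w => f (X 0%R w)) (fun w => f (X t w)) =
  (#|Omega|%:R^-1 *
   \sum_x \sum_y (f x - m) * (f y - m) * transition_prob Q t x y)%R%:E.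
Proof.
move=> symQ Q1 [mX fdd] t0 m.
pose Z w := (X 0%R w, X t w).
pose p (z : Omega * Omega) := (#|Omega|%:R^-1 * transition_prob Q t z.1 z.2)%R.
have ZE z : Z @^-1` [set z] = X 0%R @^-1` [set z.1] `&` X t @^-1` [set z.2].
  case: z => x y; apply/seteqP; split => w; rewrite /preimage /Z /=.
    by move=> [-> ->].
  by move=> [-> ->].
have mZ z : measurable (Z @^-1` [set z]).
  by rewrite ZE; apply: measurableI; apply: mX.
have PZ z : P (Z @^-1` [set z]) = (p z)%:E.
  have := fdd 1%N (fun i => if i is 0%N then 0%R else t)
    (fun i => if i is 0%N then z.1 else z.2) erefl.
  rewrite big_ord1 subr0 /= => <-; last by case.
  congr (P _); rewrite ZE; apply/seteqP; split => w.
    by move=> [/= X0 Xt] [|[|]].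
  by move=> h; split; [apply: (h 0%N)|apply: (h 1%N)].
have E1 : expectation P (fun w => f (X 0%R w)) = m%:E.
  rewrite (expectation_finite (fun z => f z.1) mZ PZ) /=; congr EFin.
  rewrite -(pair_bigA _ (fun x y => f x * p (x, y))%R) /= /m mulr_sumr.
  apply: eq_bigr => x _.
  by rewrite -!mulr_sumr transition_prob_sum1 // mulr1 mulrC.
have E2 : expectation P (fun w => f (X t w)) = m%:E.
  rewrite (expectation_finite (fun z => f z.2) mZ PZ) /=; congr EFin.
  rewrite -(pair_bigA _ (fun x y => f y * p (x, y))%R) /= /m mulr_sumr.
  rewrite exchange_big /=; apply: eq_bigr => y _.
  rewrite -!mulr_sumr; under eq_bigr do rewrite transition_prob_sym //.
  by rewrite transition_prob_sum1 // mulr1 mulrC.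
rewrite unlock E1 E2 /=.
rewrite (expectation_finite (fun z => (f z.1 - m) * (f z.2 - m))%R mZ PZ).
congr EFin.
rewrite -(pair_bigA _ (fun x y => (f x - m) * (f y - m) * p (x, y))%R) /=.
rewrite mulr_sumr; apply: eq_bigr => x _; rewrite mulr_sumr.
by apply: eq_bigr => y _; rewrite /p /= mulrCA.
Qed.

End Covariance.

(** * The interchange process and its gap along a path *)

Section Averaging.
Context {R : realType} {gT : finGroupType} (H : {group gT}).
Notation V := {ffun gT -> R^o}.
Implicit Types (f g : V).

Definition coset_avg f : V := [ffun s => #|H|%:R^-1 * \sum_(h in H) (f (h * s)%g : R)].

Lemma coset_avg_linear : linear coset_avg.
Proof.
move=> a f g; apply/ffunP => s; rewrite !ffunE /GRing.scale /=.
under eq_bigr do rewrite !ffunE /GRing.scale /=.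
by rewrite big_split /= -mulr_sumr mulrDr mulrCA.
Qed.

HB.instance Definition _ :=
  GRing.isLinear.Build R V V *:%R coset_avg coset_avg_linear.

Lemma cardH_neq0 : #|H|%:R != 0 :> R.
Proof. by rewrite pnatr_eq0 -lt0n cardG_gt0. Qed.

Lemma coset_avg_invariant f h s : h \in H -> coset_avg f (h * s)%g = coset_avg f s.
Proof.
move=> hH; rewrite !ffunE; congr (_ * _).
rewrite [RHS](reindex_inj (mulIg h)) /=.
by apply: eq_big => k; rewrite ?groupMr // mulgA.
Qed.

Lemma coset_avg_const f (k : R) s :
  (forall h, h \in H -> f (h * s)%g = k) -> coset_avg f s = k.
Proof.
move=> fk; rewrite ffunE (eq_bigr (fun=> k)) // sumr_const -[k *+ _]mulr_natr.
by rewrite mulrCA mulVf ?mulr1 // cardH_neq0.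
Qed.

Lemma coset_avg_idem f : coset_avg (coset_avg f) = coset_avg f.
Proof.
by apply/ffunP => s; apply: coset_avg_const => h hH; rewrite coset_avg_invariant.
Qed.

Lemma coset_avg_sym f g : dot (coset_avg f) g = dot f (coset_avg g).
Proof.
rewrite /dot; under eq_bigr do rewrite ffunE -mulrA mulr_suml.
under [RHS]eq_bigr do rewrite ffunE mulrCA mulr_sumr.
rewrite -!mulr_sumr; congr (_ * _).
rewrite exchange_big [RHS]exchange_big /= (reindex_inj invg_inj) /=.
apply: eq_big => h; first by rewrite groupV.
move=> _; rewrite (reindex_inj (mulgI h)) /=.
by apply: eq_bigr => s _; rewrite mulKg.
Qed.

Definition translation_defect f h : R := \sum_s ((f (h * s)%g : R) - f s) ^+ 2.

(** Translations preserve the uniform law, so the defect is the square of a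
    seminorm of the translation; (a + b)^2 <= 2 a^2 + 2 b^2 spares the square
    roots at the cost of a worse constant. *)
Lemma translation_defectM f h k :
  translation_defect f (h * k)%g <=
  2 * translation_defect f h + 2 * translation_defect f k.
Proof.
have -> : translation_defect f h =
    \sum_s ((f (h * (k * s))%g : R) - f (k * s)%g) ^+ 2.
  by rewrite [LHS](reindex_inj (mulgI k)).
rewrite !mulr_sumr -big_split; apply: ler_sum => s _ /=.
rewrite mulgA; move: (f _ : R) (f _ : R) (f _ : R) => a b c.
by have := sqr_ge0 ((c - a) - (a - b)); nra.
Qed.

(** Jensen's inequality for the average over a coset. *)
Lemma coset_avg_defect f (M : R) :
  (forall h, h \in H -> translation_defect f h <= M) ->
  dot (f - coset_avg f) (f - coset_avg f) <= M.
Proof.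
move=> hM; set n : R := #|H|%:R.
have n0 : 0 < n by rewrite ltr0n cardG_gt0.
have -> : M = n^-1 * \sum_(h in H) M.
  by rewrite sumr_const -[M *+ _]mulr_natr mulrCA mulVf ?mulr1 ?gt_eqF.
apply: (@le_trans _ _ (n^-1 * \sum_(h in H) translation_defect f h)); last first.
  by rewrite ler_pM2l ?invr_gt0 //; apply: ler_sum.
rewrite exchange_big /= mulr_sumr; apply: ler_sum => s _.
rewrite ler_pdivlMl // !ffunE -/n.
set m : R := n^-1 * _.
have mE : \sum_(h in H) (f (h * s)%g : R) = n * m.
  by rewrite mulrA mulfV ?mul1r ?gt_eqF.
have : 0 <= \sum_(h in H) ((f (h * s)%g : R) - m) ^+ 2.
  by apply: sumr_ge0 => h _; exact: sqr_ge0.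
have E (a : R) : \sum_(h in H) ((f (h * s)%g : R) - a) ^+ 2 =
    \sum_(h in H) (f (h * s)%g : R) ^+ 2 - 2 * a * (n * m) + n * a ^+ 2.
  rewrite -mE mulr_sumr -sumrN -big_split /= [n * _]mulrC mulr_natr -sumr_const.
  by rewrite -big_split /=; apply: eq_bigr => h _; ring.
rewrite !E; move: (\sum_(h in H) _ ^+ 2) => S.
move: (f s : R) m {mE E} => x m; nra.
Qed.

End Averaging.

Section Generator.
Context {R : realType} {N : nat} (nu : R) (E : {set {set 'I_N}}).
Hypothesis nu0 : 0 < nu.
Notation V := {ffun 'S_N -> R^o}.
Notation Q := (interchange_generator nu E).
Implicit Types (f g : V) (s : 'S_N).

Lemma interchange_generatorE f s : Q f s = interchange_op nu E f s.
Proof. by rewrite lfunE ffunE. Qed.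

Lemma dot_interchange f g : dot (Q f) g =
  nu * \sum_(i < N) \sum_(j < N | (i < j)%N && ([set i; j]%SET \in E))
    \sum_s ((f (tperm i j * s)%g : R) - f s) * g s.
Proof.
rewrite /dot; under eq_bigr do rewrite interchange_generatorE -mulrA.
rewrite -mulr_sumr; congr (_ * _).
under eq_bigr do rewrite mulr_suml; rewrite exchange_big /=.
apply: eq_bigr => i _; under eq_bigr do rewrite mulr_suml.
by rewrite exchange_big.
Qed.

Lemma interchange_self_adjoint : self_adjoint Q.
Proof.
move=> f g; rewrite [RHS]dotC !dot_interchange; congr (_ * _).
apply: eq_bigr => i _; apply: eq_bigr => j _.
under eq_bigr do rewrite mulrBl; under [RHS]eq_bigr do rewrite mulrBl.
rewrite !sumrB; congr (_ - _); last by apply: eq_bigr => s _; rewrite mulrC.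
rewrite (reindex_inj (mulgI (tperm i j))) /=; apply: eq_bigr => s _.
by rewrite mulgA tperm2 mul1g mulrC.
Qed.

Lemma interchange_const : Q [ffun=> 1] = 0.
Proof.
apply/ffunP => s; rewrite interchange_generatorE /interchange_op big1 ?mulr0 ?ffunE //.
by move=> i _; rewrite big1 // => j _; rewrite !ffunE subrr.
Qed.

Lemma interchange_dirichlet f : - dot (Q f) f =
  nu / 2 * \sum_(i < N) \sum_(j < N | (i < j)%N && ([set i; j]%SET \in E))
    translation_defect f (tperm i j).
Proof.
rewrite dot_interchange -mulrN -mulrA -sumrN; congr (_ * _).
rewrite mulr_sumr; apply: eq_bigr => i _.
rewrite mulr_sumr -sumrN; apply: eq_bigr => j _.
rewrite /translation_defect.
set a := \sum_s _; set b := \sum_s _; suff : a + a + b = 0 by lra.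
rewrite {1}/a (reindex_inj (mulgI (tperm i j))) /= -!big_split big1 //= => s _.
by rewrite mulgA tperm2 mul1g; ring.
Qed.

Lemma interchange_form_le0 f : dot (Q f) f <= 0.
Proof.
rewrite -oppr_ge0 interchange_dirichlet; apply: mulr_ge0.
  by apply: divr_ge0 => //; exact: ltW.
by do 2![apply: sumr_ge0 => ? _]; apply: sumr_ge0 => ? _; exact: sqr_ge0.
Qed.

Lemma edge_defect_le f a b : a != b -> [set a; b]%SET \in E ->
  translation_defect f (tperm a b) <= 2 / nu * - dot (Q f) f.
Proof.
wlog ab : a b / (a < b)%N => [hw|_ abE].
  rewrite neq_ltn => /orP[] h; first by apply: hw => //; rewrite neq_ltn h.
  by rewrite tpermC finset.setUC => hE; apply: hw => //; rewrite neq_ltn h.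
have td0 i j : 0 <= translation_defect f (tperm i j).
  by apply: sumr_ge0 => ? _; exact: sqr_ge0.
have -> : 2 / nu * - dot (Q f) f =
    \sum_(i < N) \sum_(j < N | (i < j)%N && ([set i; j]%SET \in E))
    translation_defect f (tperm i j).
  rewrite interchange_dirichlet; move: (\sum_(i < N) _) => S.
  by field; rewrite gt_eqF.
rewrite (bigD1 a) //= (bigD1 b) /=; last by rewrite ab abE.
by rewrite -addrA lerDl addr_ge0 // !sumr_ge0 // => ? _; rewrite sumr_ge0.
Qed.

Section Path.
Context (B : nat) (v : nat -> 'I_N).
Hypothesis vinj : forall i j, (i < B)%N -> (j < B)%N -> v i = v j -> i = j.
Hypothesis vE : forall i, (i.+1 < B)%N -> [set v i; v i.+1]%SET \in E.

Definition path_set : {set 'I_N} := [set v (i : 'I_B) | i : 'I_B]%SET.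

(** The transposition of two points of the path is conjugate, by the next
    adjacent transposition, to that of two points one step closer. *)
Lemma path_tperm_defect f (M : R) i k : 0 <= M ->
  (forall i, (i.+1 < B)%N -> translation_defect f (tperm (v i) (v i.+1)) <= M) ->
  (i + k < B)%N -> translation_defect f (tperm (v i) (v (i + k))) <= 10 ^+ k * M.
Proof.
move=> M0 hM; elim: k => [|k IH] ikB.
  rewrite addn0 tperm1 /translation_defect big1 ?mulr_ge0 // => s _.
  by rewrite mul1g subrr expr0n.
rewrite addnS in ikB *.
have ik := ltnW ikB.
have tE : tperm (v i) (v (i + k).+1) =
  (if k is 0 then tperm (v i) (v i.+1) else
   tperm (v (i + k)) (v (i + k).+1) *
   (tperm (v i) (v (i + k)) * tperm (v (i + k)) (v (i + k).+1)))%g.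
  case: k ik ikB {IH} => [|k] ik ikB; first by rewrite addn0.
  transitivity (tperm (v i) (v (i + k.+1)) ^
                tperm (v (i + k.+1)) (v (i + k.+1).+1))%g; last first.
    by rewrite conjgE tpermV.
  rewrite tpermJ tpermL tpermD //.
    by apply/eqP => /vinj h; have := h ik (leq_ltn_trans (leq_addr _ _) ik); lia.
  by apply/eqP => /vinj h; have := h ikB (leq_ltn_trans (leq_addr _ _) ik); lia.
rewrite tE; case: k ik ikB IH {tE} => [|k] ik ikB IH.
  rewrite addn0 in ikB.
  by apply: le_trans (hM _ ikB) _; rewrite expr1 ler_peMl //; lra.
apply: le_trans (translation_defectM _ _ _) _.
have := translation_defectM f (tperm (v i) (v (i + k.+1)))
          (tperm (v (i + k.+1)) (v (i + k.+1).+1)).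
have := hM _ ikB; have := IH ik.
rewrite [10 ^+ k.+2]exprS.
have : M <= 10 ^+ k.+1 * M by rewrite ler_peMl // exprn_ege1 //; lra.
rewrite -mulrA.
move: (10 ^+ k.+1 * M) (translation_defect _ _) (translation_defect _ _)
  (translation_defect _ _) => *.
lra.
Qed.

(** A permutation becomes a product of transpositions, at most one for each
    point that it moves. *)
Lemma path_set_defect f (M : R) h : 0 <= M ->
  (forall i, (i.+1 < B)%N -> translation_defect f (tperm (v i) (v i.+1)) <= M) ->
  perm_on path_set h -> translation_defect f h <= 40 ^+ B * M.
Proof.
move=> M0 hM hA.
have tA a b : a \in path_set -> b \in path_set ->
    translation_defect f (tperm a b) <= 10 ^+ B * M.
  have main (i j : 'I_B) : (i <= j)%N ->
      translation_defect f (tperm (v i) (v j)) <= 10 ^+ B * M.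
    move=> ij; rewrite -{1}(subnKC ij).
    apply: le_trans (path_tperm_defect M0 hM _) _; first by rewrite subnKC.
    apply: ler_wpM2r => //; apply: ler_weXn2l; first lra.
    by have := ltn_ord j; lia.
  move=> /imsetP[i _ ->] /imsetP[j _ ->].
  by case: (leqP i j) => [/main//|/ltnW/main]; rewrite tpermC.
suff gen m : (#|[set x | h x != x]%SET| <= m)%N ->
    translation_defect f h <= 4 ^+ m * (10 ^+ B * M).
  have le : (#|[set x | h x != x]%SET| <= B)%N.
    apply: leq_trans (_ : #|path_set| <= B)%N; last first.
      by rewrite -[X in (_ <= X)%N]card_ord; apply: leq_imset_card.
    apply: subset_leq_card; apply/fintype.subsetP => x; rewrite inE => hx.
    by apply: (fintype.subsetP hA); rewrite inE.
  by apply: le_trans (gen _ le) _; rewrite mulrA -exprMn -natrM.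
have C0 : 0 <= 10 ^+ B * M by rewrite mulr_ge0 // exprn_ge0.
elim: m h hA => [|m IH] h hA.
  rewrite leqn0 cards_eq0 => /eqP h0.
  have -> : h = 1%g.
    apply/permP => x; rewrite perm1; apply/eqP/negPn/negP => hx.
    have : x \in [set x | h x != x]%SET by rewrite inE.
    by rewrite h0 inE.
  rewrite /translation_defect big1 ?expr0 ?mul1r // => s _.
  by rewrite mul1g subrr expr0n.
move=> hm; case: (set_0Vmem [set x | h x != x]%SET) => [h0|[x]].
  apply: le_trans (IH h hA _) _; first by rewrite h0 cards0.
  by apply: ler_wpM2r => //; apply: ler_weXn2l; [lra|].
rewrite inE => hx.
have xA : x \in path_set by apply: (fintype.subsetP hA); rewrite inE.
have hxA : h x \in path_set by rewrite (perm_closed _ hA).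
(* h * t fixes x and every fixed point of h. *)
pose t := tperm (h x) x.
have -> : h = (h * t * t)%g by rewrite -mulgA tperm2 mulg1.
apply: le_trans (translation_defectM _ _ _) _.
have H1 : translation_defect f t <= 10 ^+ B * M by apply: tA.
have H2 : translation_defect f (h * t)%g <= 4 ^+ m * (10 ^+ B * M).
  apply: IH.
    apply: perm_onM => //; apply/fintype.subsetP => y; rewrite inE /t.
    by case: tpermP => [->|->|] //; rewrite eqxx.
  rewrite -ltnS; apply: leq_trans hm; apply: proper_card.
  apply/properP; split.
    apply/fintype.subsetP => y; rewrite !inE permM; apply: contraNN => /eqP hy.
    have xy : x != y by apply: contraNneq hx => ->; rewrite hy.
    have hxy : h x != y.
      by apply: contraNneq hx => hxy; apply/eqP/(@perm_inj _ h); rewrite hxy hy.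
    by rewrite hy /t tpermD.
  by exists x; rewrite !inE // permM /t tpermL eqxx.
have : 10 ^+ B * M <= 4 ^+ m * (10 ^+ B * M) by rewrite ler_peMl // exprn_ege1 //; lra.
rewrite exprS -mulrA.
by lra.
Qed.

(** A crude constant suffices, as long as it does not depend on the graph
    outside the path. *)
Lemma path_poincare (H : {group 'S_N}) f : (forall h, h \in H -> perm_on path_set h) ->
  nu / (2 * 40 ^+ B) * dot (f - coset_avg H f) (f - coset_avg H f) <= - dot (Q f) f.
Proof.
move=> HA; set D := - dot (Q f) f.
have D0 : 0 <= D by rewrite oppr_ge0 interchange_form_le0.
have p0 : 0 < 40 ^+ B :> R by rewrite exprn_gt0.
have := @coset_avg_defect R _ H f (40 ^+ B * (2 / nu * D)).
have -> : 40 ^+ B * (2 / nu * D) = (nu / (2 * 40 ^+ B))^-1 * D.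
  by field; rewrite !gt_eqF.
rewrite ler_pdivlMl ?divr_gt0 ?mulr_gt0 //; apply => h hH.
have -> : (nu / (2 * 40 ^+ B))^-1 * D = 40 ^+ B * (2 / nu * D).
  by field; rewrite !gt_eqF.
apply: path_set_defect; last exact: HA.
  by apply: mulr_ge0 => //; apply: divr_ge0 => //; exact: ltW.
move=> i iB; apply: edge_defect_le; last exact: vE.
by apply/eqP => /(vinj (ltnW iB) iB); lia.
Qed.

End Path.
End Generator.

Lemma card_path_set N B (v : nat -> 'I_N) :
  (forall i j, (i < B)%N -> (j < B)%N -> v i = v j -> i = j) ->
  #|path_set B v| = B.
Proof.
move=> vinj; rewrite card_imset ?card_ord // => i j.
by move=> /(vinj _ _ (ltn_ord i) (ltn_ord j)); exact: val_inj.
Qed.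

(** * Induced permutations *)

Section InducedPermutation.
Context {T : finType}.
Implicit Types (s h r : {perm T}) (x y z : T) (A : {set T}).

(** The new permutation cuts z out of its cycle, sending the predecessor of z to
    s z. *)
Lemma porbit_bypass s z x y : x != z -> y != z ->
  (y \in porbit (s * tperm z (s z))%g x) = (y \in porbit s x).
Proof.
move=> xz yz; set r := (s * _)%g.
have rE u : u != z -> r u = if s u == z then s z else s u.
  move=> uz; rewrite /r permM; case: tpermP => [->|/perm_inj uz'|/eqP/negbTE -> //].
    by rewrite eqxx.
  by rewrite uz' eqxx in uz.
have rz : r z = z by rewrite /r permM tpermR.
clearbody r.
apply/idP/idP => /porbitP[i yE].
  suff [_ [k ik]] : (r ^+ i)%g x != z /\ exists k, (r ^+ i)%g x = (s ^+ k)%g x.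
    by rewrite yE ik mem_porbit.
  elim: i {yE} => [|i [iz [k ik]]].
    by rewrite expg0 perm1; split => //; exists 0%N; rewrite expg0 perm1.
  rewrite expgSr permM; split.
    by apply: contraNneq iz => e; apply/eqP/(@perm_inj _ r); rewrite rz.
  rewrite rE // ik; case: eqP => [sz|_].
    by exists k.+2; rewrite !expgSr !permM sz.
  by exists k.+1; rewrite !expgSr !permM.
(* The orbit of s follows that of r, except for a detour of one step at z. *)
have key k : ((s ^+ k)%g x != z -> (s ^+ k)%g x \in porbit r x) /\
             ((s ^+ k)%g x = z -> s z \in porbit r x).
  elim: k => [|k [IH1 IH2]].
    rewrite expg0 perm1; split; first by rewrite porbit_id.
    by move=> xz'; rewrite xz' eqxx in xz.
  rewrite expgSr permM; have [kz|kz] := eqVneq ((s ^+ k)%g x) z.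
    by rewrite kz; split => [_|_]; exact: IH2.
  have /porbitP[j jE] := IH1 kz.
  have rin : r ((s ^+ k)%g x) \in porbit r x.
    by rewrite jE; apply/porbitP; exists j.+1; rewrite expgSr permM.
  rewrite rE // in rin; split => [/negbTE nz|ez]; first by rewrite nz in rin.
  by rewrite ez eqxx in rin.
by rewrite yE; apply: (key i).1; rewrite -yE.
Qed.

(** Bypassing a point outside A commutes with first applying a permutation h
    supported in A, because h fixes that point. Bypassing all of them in turn
    yields the first-return map on A, with the same cycles up to points
    outside A. *)
Lemma induced_perm A s : exists2 r, perm_on A r &
  forall h x y, perm_on A h -> x \in A -> y \in A ->
    (y \in porbit (h * s)%g x) = (y \in porbit (h * r)%g x).
Proof.
suff gen (zs : seq T) : {subset zs <= [predC A]} -> exists2 r : {perm T},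
    {in zs, forall z, r z = z} &
    forall h x y, perm_on A h -> x \in A -> y \in A ->
    (y \in porbit (h * s)%g x) = (y \in porbit (h * r)%g x).
  have [|r rfix rP] := gen (enum [predC A]).
    by move=> z; rewrite mem_enum.
  exists r => //; apply/fintype.subsetP => z; apply: contraLR => zA.
  by apply/negPn/eqP/rfix; rewrite mem_enum.
elim: zs => [|z zs IH] zsA; first by exists s.
have zA : z \notin A by have := zsA z (mem_head _ _); rewrite inE.
have [|r rfix rP] := IH.
  by move=> w wzs; apply: zsA; rewrite inE wzs orbT.
exists (r * tperm z (r z))%g.
  move=> w; rewrite inE permM => /orP[/eqP ->|/rfix wfix]; first by rewrite tpermR.
  rewrite wfix; case: tpermP => [e|e|//]; first by rewrite -e wfix.
  by move: e; rewrite -{1}wfix => /perm_inj.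
move=> h x y hA xA yA; rewrite rP // mulgA.
have -> : r z = (h * r)%g z by rewrite permM (out_perm hA).
by rewrite porbit_bypass //; apply: contraNneq zA => <-.
Qed.

(** As h runs through Sym A, so does the product of h with the induced
    permutation r. *)
Lemma coset_avg_trace (R : realType) A (g : {ffun {perm T} -> R^o}) s :
  (forall s s', (forall x y, x \in A -> y \in A ->
     (y \in porbit s x) = (y \in porbit s' x)) -> g s = g s') ->
  coset_avg (Sym_group A) g s = coset_avg (Sym_group A) g 1%g.
Proof.
move=> gP; have [r rA rP] := induced_perm A s.
rewrite -[RHS](@coset_avg_invariant _ _ _ _ r); last by rewrite inE.
rewrite mulg1 !ffunE; congr (_ * _); apply: eq_bigr => h; rewrite inE => hA.
by apply: gP => x y xA yA; apply: rP.
Qed.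

End InducedPermutation.

(** * Cycle lengths of uniform permutations *)

Section CycleLengths.
Context {T : finType}.
Implicit Types (s : {perm T}) (x y z : T).
Notation cyc s x := #|porbit s x|.

Lemma card_perm_full : #|{perm T}| = (#|T|)`!.
Proof.
rewrite -[in RHS]finset.cardsT -card_perm; apply/esym/eq_card => s; rewrite !inE.
by apply/fintype.subsetP => z _; rewrite inE.
Qed.

(** If s has a cycle of length l through x, redirecting to z the arrow of s that
    closes this cycle is injective in the pair (s, z), as z is the l-th iterate
    of x under the new permutation; z ranges over x and the points off the
    cycle. *)
Lemma cycle_length_count x l :
  (#|[set s : {perm T} | cyc s x == l]%SET| * (#|T| - l + 1) <= (#|T|)`!)%N.
Proof.
pose D := [set p : {perm T} * T |
  (cyc p.1 x == l) && ((p.2 == x) || (p.2 \notin porbit p.1 x))]%SET.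
have <- : #|D| = (#|[set s : {perm T} | cyc s x == l]%SET| * (#|T| - l + 1))%N.
  rewrite -sum1_card.
  transitivity (\sum_(s : {perm T} | cyc s x == l)
      \sum_(z | (z == x) || (z \notin porbit s x)) 1)%N.
    by rewrite pair_big_dep; apply: eq_bigl => -[s z]; rewrite inE.
  rewrite -sum_nat_const; apply: eq_big => [s|s /eqP sl]; first by rewrite inE.
  rewrite (bigD1 x) /= ?eqxx // addnC sum1_card; congr (_ + 1)%N.
  rewrite -sl -(cardC (mem (porbit s x))) addKn.
  apply: eq_card => z; rewrite unfold_in [in RHS]inE /=.
  have [->|_] := eqVneq z x; last by rewrite andbT.
  by rewrite andbF; apply/esym/negbTE; rewrite negbK porbit_id.
pose phi (p : {perm T} * T) := (p.1 * tperm x p.2)%g.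
rewrite -card_perm_full -(card_in_imset (f := phi)); first exact: max_card.
have ret p : p \in D -> iter l (phi p) x = p.2.
  rewrite inE => /andP[/eqP lE zP].
  (* The iterates of x before the l-th avoid x and z, so both permutations agree
     there. *)
  have step j : (j < l)%N -> iter j (phi p) x = iter j p.1 x.
    elim: j => [//|j IH] jl; rewrite !iterS IH ?(ltnW jl) // /phi permM tpermD //.
      apply/eqP => e; have := uniq_traject_porbit p.1 x.
      rewrite lE => u; have l0 : (0 < l)%N by apply: leq_trans jl.
      have := nth_uniq x (s := traject p.1 x l) (i := 0) (j := j.+1).
      rewrite size_traject => /(_ l0 jl u).
      by rewrite !nth_traject //= -e eqxx.
    apply/eqP => e; case/orP: zP => [/eqP zx|/negP[]]; last first.
      by rewrite e -iterS -permX mem_porbit.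
    have := uniq_traject_porbit p.1 x.
    rewrite lE => u; have l0 : (0 < l)%N by apply: leq_trans jl.
    have := nth_uniq x (s := traject p.1 x l) (i := 0) (j := j.+1).
    rewrite size_traject => /(_ l0 jl u).
    by rewrite !nth_traject //= -e zx eqxx.
  have : (0 < l)%N by rewrite -lE lt0n card_porbit_neq0.
  case: l lE step {D} => // l lE step _.
  by rewrite iterS step // /phi permM -iterS -lE iter_porbit tpermL.
move=> p q pD qD e.
have e2 : p.2 = q.2 by rewrite -(ret p pD) -(ret q qD) e.
have : (p.1 * tperm x p.2 = q.1 * tperm x p.2)%g by rewrite {2}e2.
by case: p q e2 {e pD qD} => [s z] [s' z'] /= <- /mulIg ->.
Qed.

Lemma cycle_window_count x a b : (b < #|T|)%N ->
  (#|[set s : {perm T} | (a < cyc s x <= b)%N]%SET| * (#|T| - b) <=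
   (b - a) * (#|T|)`!)%N.
Proof.
elim: b => [|b IH] bT.
  rewrite (_ : [set s | _]%SET = finset.set0) ?cards0 //.
  by apply/setP => s; rewrite !inE; lia.
have [ab|ba] := ltnP b a.
  rewrite (_ : [set s | _]%SET = finset.set0) ?cards0 //.
  by apply/setP => s; rewrite !inE; lia.
have : (#|[set s : {perm T} | (a < cyc s x <= b.+1)%N]%SET| <=
   #|[set s : {perm T} | (a < cyc s x <= b)%N]%SET| +
   #|[set s : {perm T} | cyc s x == b.+1]%SET|)%N.
  apply: leq_trans (leq_card_setU _ _); apply: subset_leq_card.
  by apply/fintype.subsetP => s; rewrite !inE; lia.
have := cycle_length_count x b.+1; have := IH (ltnW bT).
move: (#|_|) (#|_|) (#|_|) (_`!) => *; nia.
Qed.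

(** A cycle of length l is seen from l points, which turns the bound for the
    cycle of one point into a bound for the existence of a cycle. *)
Lemma cycle_window_bound a b : (b < #|T|)%N ->
  (#|[set s : {perm T} | [exists x, (a < cyc s x <= b)%N]]%SET| *
    (a.+1 * (#|T| - b)) <= #|T| * ((b - a) * (#|T|)`!))%N.
Proof.
move=> bT; rewrite mulnA.
set S := [set s | _]%SET.
apply: (@leq_trans ((\sum_(x : T) #|[set s : {perm T} | (a < cyc s x <= b)%N]%SET|)
     * (#|T| - b))%N).
  rewrite leq_mul2r; apply/orP; right.
  under eq_bigr do rewrite -sum1_card.
  rewrite (exchange_big_dep predT) //= -sum_nat_const big_mkcond /=.
  apply: leq_sum => s _; case: ifP => //; rewrite inE => /existsP[x xs].
  apply: (@leq_trans (cyc s x)); first by case/andP: xs.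
  rewrite sum1_card; apply: subset_leq_card; apply/fintype.subsetP => y.
  rewrite -eq_porbit_mem => /eqP yx; rewrite unfold_in /=.
  suff : s \in [set s0 : {perm T} | (a < cyc s0 y <= b)%N]%SET by [].
  by rewrite inE yx.
rewrite big_distrl /= -sum_nat_const.
by apply: leq_sum => x _; apply: cycle_window_count.
Qed.

(** Conjugation acts transitively on the ordered pairs of distinct points; it is
    enough to conjugate by transpositions moving one point of the pair. *)
Lemma same_cycle_count : exists2 k : nat, (k <= (#|T|)`!)%N &
  forall x y, x != y -> #|[set s : {perm T} | y \in porbit s x]%SET| = k.
Proof.
pose n x y := #|[set s : {perm T} | y \in porbit s x]%SET|.
have nC x y : n x y = n y x by apply: eq_card => s; rewrite !inE porbit_sym.
(* Conjugation by the transposition of y and y' fixes x. *)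
have nR x y y' : x != y -> x != y' -> n x y = n x y'.
  move=> xy xy'; rewrite /n -(card_imset _ (conjg_inj (tperm y y'))).
  have J s i z : ((s ^ tperm y y') ^+ i)%g (tperm y y' z) = tperm y y' ((s ^+ i)%g z).
    by rewrite -conjXg /conjg !permM permK.
  have tx : tperm y y' x = x by rewrite tpermD // eq_sym.
  apply: eq_card => s; apply/imsetP/idP => [[r]|]; rewrite !inE.
    move=> /porbitP[i yE] ->; apply/porbitP; exists i.
    by rewrite -{1}tx J -yE tpermL.
  move=> /porbitP[i yE]; exists (s ^ tperm y y')%g.
    by rewrite inE; apply/porbitP; exists i; rewrite -{1}tx J -yE tpermR.
  by rewrite -conjgM tperm2 conjg1.
have nE x y x' y' : x != y -> x' != y' -> n x y = n x' y'.
  move=> xy xy'; have [e|yx] := eqVneq y' x.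
    have xx' : x != x' by rewrite eq_sym -e.
    by rewrite e (nR x y x' xy xx') nC.
  have xy'2 : x != y' by rewrite eq_sym.
  have y'x' : y' != x' by rewrite eq_sym.
  by rewrite (nR x y y' xy xy'2) nC (nR y' x x' yx y'x') nC.
case: (pickP (fun p : T * T => p.1 != p.2)) => [[a b] /= ab|none].
  exists (n a b); last by move=> x y xy; apply: nE.
  by rewrite -card_perm_full; exact: max_card.
by exists 0%N => // x y xy; have := none (x, y); rewrite /= xy.
Qed.

End CycleLengths.

(** * Sampling the largest cycle *)

Section Sampling.
Context {R : realType} {T : finType} (A : {set T}).
Hypothesis A0 : (0 < #|A|)%N.
Implicit Types (s : {perm T}) (x y : T).

(** Centred so that the total mass is 0, while the mass of a cycle C is the
    deviation of |C :&: A| / |A| from |C| / |T|. *)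
Definition sample_weight x : R := (x \in A)%:R / #|A|%:R - #|T|%:R^-1.

Let B0 : #|A|%:R != 0 :> R. Proof. by rewrite pnatr_eq0 -lt0n. Qed.
Let N0 : #|T|%:R != 0 :> R.
Proof. by rewrite pnatr_eq0 -lt0n (leq_trans A0) // max_card. Qed.

Lemma sum_sample_weight (C : {set T}) :
  \sum_(x in C) sample_weight x = #|C :&: A|%:R / #|A|%:R - #|C|%:R / #|T|%:R.
Proof.
rewrite sumrB; congr (_ - _); last first.
  by rewrite sumr_const -[_ *+ #|C|]mulr_natr mulrC.
rewrite -mulr_suml; congr (_ / _).
rewrite -natr_sum -sum1_card; congr (_%:R).
rewrite [RHS]big_mkcond [LHS]big_mkcond /=; apply: eq_bigr => x _.
by rewrite inE; case: (x \in C).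
Qed.

Lemma sum_sample_weight_sqr : \sum_x sample_weight x ^+ 2 <= #|A|%:R^-1.
Proof.
(* The indicator of A is idempotent, so the square is affine in it. *)
have E x : sample_weight x ^+ 2 =
    (#|A|%:R^-1 - 2 / #|T|%:R) * ((x \in A)%:R / #|A|%:R) + (#|T|%:R ^- 2).
  rewrite /sample_weight; case: (x \in A) => /=; first by field; rewrite B0 N0.
  by field; rewrite B0 N0.
have EA : \sum_x (x \in A)%:R / #|A|%:R = 1 :> R.
  rewrite -mulr_suml -natr_sum (_ : (\sum_x (x \in A) = #|A|)%N) ?divff //.
  by rewrite -sum1_card [RHS]big_mkcond; apply: eq_bigr => x _; case: (x \in A).
have EN : \sum_(x : T) #|T|%:R ^- 2 = #|T|%:R^-1 :> R.
  by rewrite sumr_const -[_ ^- 2 *+ _]mulr_natr expr2 invfM mulfVK.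
under eq_bigr do rewrite E.
rewrite big_split /= -mulr_sumr EA EN mulr1.
have : 0 <= #|T|%:R^-1 :> R by rewrite invr_ge0.
lra.
Qed.

(** The sum over the cycles of the squares of their masses, in a form that can be
    averaged over s pair by pair. *)
Definition cycle_discrepancy s : R :=
  \sum_x \sum_y (y \in porbit s x)%:R * (sample_weight x * sample_weight y).

Lemma cycle_discrepancy_ge s x :
  (#|porbit s x :&: A|%:R / #|A|%:R - #|porbit s x|%:R / #|T|%:R) ^+ 2 <=
  cycle_discrepancy s.
Proof.
have -> : cycle_discrepancy s =
    \sum_(C : {set T}) (\sum_(x | porbit s x == C) sample_weight x) ^+ 2.
  rewrite /cycle_discrepancy (partition_big (porbit s) predT) //=.
  apply: eq_bigr => C _; rewrite expr2 mulr_suml; apply: eq_bigr => u /eqP uC.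
  rewrite mulr_sumr [RHS]big_mkcond /=; apply: eq_bigr => y _.
  rewrite -uC eq_porbit_mem.
  by case: (_ \in _); rewrite ?mul1r ?mul0r.
rewrite (bigD1 (porbit s x)) //= -sum_sample_weight.
under [X in X ^+ 2 <= _]eq_bigl do rewrite -eq_porbit_mem.
by rewrite lerDl; apply: sumr_ge0 => C _; exact: sqr_ge0.
Qed.

(** The events that two distinct points lie in the same cycle all have the same
    probability and the weights sum to 0, so only the diagonal terms contribute
    to the mean. *)
Lemma sum_cycle_discrepancy :
  \sum_(s : {perm T}) cycle_discrepancy s <= (#|T|)`!%:R / #|A|%:R.
Proof.
have [k kN kE] := same_cycle_count (T := T).
have -> : \sum_(s : {perm T}) cycle_discrepancy s =
    \sum_x \sum_y k%:R * (sample_weight x * sample_weight y) +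
    \sum_x ((#|T|)`!%:R - k%:R) * sample_weight x ^+ 2.
  rewrite /cycle_discrepancy exchange_big -big_split; apply: eq_bigr => x _ /=.
  rewrite exchange_big (bigD1 x) //= [in RHS](bigD1 x) //=.
  rewrite addrAC; congr (_ + _).
    under eq_bigr do rewrite porbit_id mul1r.
    rewrite sumr_const card_perm_full -[_ *+ _]mulr_natr; ring.
  apply: eq_bigr => y yx; rewrite -mulr_suml; congr (_ * _).
  rewrite -natr_sum -(kE x y) 1?eq_sym // -sum1_card big_mkcond /=.
  by congr (_%:R); rewrite [RHS]big_mkcond; apply: eq_bigr => s _; rewrite inE.
have W0 : \sum_x sample_weight x = 0.
  have := sum_sample_weight finset.setT.
  rewrite finset.setTI finset.cardsT !divff // subrr => E; rewrite -[RHS]E.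
  by apply: eq_bigl => x; rewrite inE.
rewrite big1 ?add0r => [|x _]; last by rewrite -!mulr_sumr W0 !mulr0.
rewrite -mulr_sumr; apply: ler_pM => //.
- by rewrite subr_ge0 ler_nat.
- by apply: sumr_ge0 => x _; exact: sqr_ge0.
- by rewrite lerBlDr lerDl.
- exact: sum_sample_weight_sqr.
Qed.

(** Markov's inequality for the discrepancy. *)
Lemma cycle_deviation_bound (eps : R) : 0 < eps ->
  #|[set s : {perm T} | [exists x, eps <=
      `|#|porbit s x :&: A|%:R / #|A|%:R - #|porbit s x|%:R / #|T|%:R|]]%SET|%:R
  <= (#|T|)`!%:R / (#|A|%:R * eps ^+ 2).
Proof.
move=> e0; rewrite invfM mulrA ler_pdivlMr ?exprn_gt0 //.
apply: le_trans sum_cycle_discrepancy.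
rewrite -sum1_card natr_sum mulr_suml big_mkcond /=; apply: ler_sum => s _.
rewrite inE; case: ifP => [/existsP[x xs]|_].
  rewrite mul1r; apply: le_trans (cycle_discrepancy_ge s x).
  by rewrite -[leRHS]real_normK ?num_real // lerXn2r ?nnegrE // ltW.
case: (pickP T) => [x _|T0].
  by apply: le_trans (cycle_discrepancy_ge s x); exact: sqr_ge0.
by rewrite /cycle_discrepancy big1 // => x; have := T0 x.
Qed.

End Sampling.

Section LargestCycle.
Context {R : realType} {N : nat} (c : R).
Implicit Types (s : 'S_N) (A : {set 'I_N}).
Hypothesis c0 : 0 < c.

Lemma xiE s : (0 < N)%N -> xi c s = [exists x, c * N%:R <= #|porbit s x|%:R].
Proof.
move=> N0; apply/idP/existsP => [|[x xc]]; last first.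
  apply: le_trans xc _; rewrite ler_nat /longest_cycle.
  by apply: (@leq_bigmax_cond _ _ (fun C : {set 'I_N} => #|C|)); apply: imset_f.
rewrite /xi; have [C Cin CE] : exists2 C, C \in porbits s & longest_cycle s = #|C|.
  have := @eq_bigmax_cond _ (mem (porbits s)) (fun C : {set 'I_N} => #|C|).
  case; first by apply/card_gt0P; exists (porbit s (Ordinal N0)); apply: imset_f.
  by move=> C Cin CE; exists C.
by rewrite CE; case/imsetP: Cin => x _ ->; exists x.
Qed.

Definition xi_trace A s : bool :=
  [exists x in A, c * #|A|%:R <= #|porbit s x :&: A|%:R].

(** If no cycle has length in the window ]m - k, m + k], a cycle responsible for
    the disagreement has a length at distance at least k from c N, on the side
    of c N opposite to what its trace suggests, so that the frequency of A on it
    is off by at least k / N. *)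
Lemma xi_trace_approx A (m k : nat) : (0 < #|A|)%N -> (0 < k)%N -> (k <= m)%N ->
  (m + k < N)%N -> m%:R <= c * N%:R -> c * N%:R < m.+1%:R ->
  #|[set s : 'S_N | xi c s != xi_trace A s]%SET|%:R <=
  N`!%:R * (N%:R ^+ 2 / (#|A|%:R * k%:R ^+ 2) +
            N%:R * (2 * k%:R) / ((m - k).+1%:R * (N - (m + k))%:R)) :> R.
Proof.
move=> A0 k0 km mkN mc cm.
have N0 : (0 < N)%N by apply: leq_ltn_trans mkN.
have n0 : 0 < N%:R :> R by rewrite ltr0n.
have a0 : 0 < #|A|%:R :> R by rewrite ltr0n.
have kk0 : 0 < k%:R :> R by rewrite ltr0n.
have e0 : 0 < k%:R / N%:R :> R by rewrite divr_gt0.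
set S1 := [set s : 'S_N | [exists x, (m - k < #|porbit s x| <= m + k)%N]]%SET.
set S2 := [set s : 'S_N | [exists x, k%:R / N%:R <=
   `|#|porbit s x :&: A|%:R / #|A|%:R - #|porbit s x|%:R / #|'I_N|%:R : R|]]%SET.
have b1 : #|S1|%:R <=
    N`!%:R * (N%:R * (2 * k%:R) / ((m - k).+1%:R * (N - (m + k))%:R)) :> R.
  have := @cycle_window_bound 'I_N (m - k) (m + k).
  rewrite card_ord => /(_ mkN); rewrite -/S1 => le1.
  rewrite mulrA ler_pdivlMr ?mulr_gt0 ?ltr0n ?subn_gt0 //.
  rewrite -!natrM ler_nat; apply: leq_trans le1 _.
  have -> : (m + k - (m - k) = 2 * k)%N by move: km; clear; lia.
  by rewrite mulnA mulnC.
have b2 : #|S2|%:R <= N`!%:R * (N%:R ^+ 2 / (#|A|%:R * k%:R ^+ 2)) :> R.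
  have := cycle_deviation_bound A0 e0.
  rewrite -/S2 card_ord => /le_trans; apply.
  rewrite le_eqVlt; apply/orP; left; apply/eqP.
  by field; rewrite !gt_eqF.
rewrite mulrDr; apply: le_trans (lerD b2 b1); rewrite -natrD ler_nat.
apply: leq_trans (leq_card_setU _ _); apply: subset_leq_card.
apply/fintype.subsetP => s; rewrite !inE => sP.
apply/orP; case: (boolP (s \in S1)); first by rewrite inE; right.
rewrite inE => /existsPn win; left.
have far x : (#|porbit s x| <= m - k)%N \/ (m + k < #|porbit s x|)%N.
  by move: (win x); clear; lia.
move: sP; rewrite xiE // => sP; apply/existsP.
have [/existsP[x xc]|/existsPn nx] := boolP [exists x, c * N%:R <= #|porbit s x|%:R].
  exists x; rewrite card_ord.
  have big : c * N%:R + k%:R <= #|porbit s x|%:R.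
    have [lo|hi] := far x.
      have : (m <= #|porbit s x|)%N by rewrite -(ler_nat R) (le_trans mc).
      by move: lo k0 km; clear; lia.
    have : (m + k).+1%:R <= #|porbit s x|%:R :> R by rewrite ler_nat.
    rewrite -addSn natrD; lra.
  have small : #|porbit s x :&: A|%:R < c * #|A|%:R.
    case: (set_0Vmem (porbit s x :&: A)) => [->|[y]].
      by rewrite cards0 mulr_gt0.
    rewrite inE -eq_porbit_mem => /andP[/eqP yx yA].
    rewrite ltNge; apply: contra sP => yc.
    have -> : xi_trace A s by apply/existsP; exists y; rewrite yA yx.
    by rewrite eq_sym; apply/eqP/esym/existsP; exists x.
  rewrite distrC; apply: le_trans (ler_norm _).
  have : #|porbit s x :&: A|%:R / #|A|%:R <= c by rewrite ler_pdivrMr // ltW.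
  have : c + k%:R / N%:R <= #|porbit s x|%:R / N%:R.
    by rewrite ler_pdivlMr // mulrDl divfK ?gt_eqF.
  by move: (_ / _) (_ / _) (_ / _) => *; lra.
have : xi_trace A s.
  move: sP; apply: contraR => /negbTE ->.
  by apply/eqP/negbTE/existsPn.
move=> /existsP[x /andP[xA xc]]; exists x; rewrite card_ord.
have small : #|porbit s x|%:R <= c * N%:R - k%:R.
  have lt : (#|porbit s x| < m.+1)%N.
    by rewrite -(ltr_nat R); apply: lt_trans cm; rewrite ltNge.
  have [lo|hi] := far x; last by move: lt hi; clear; lia.
  have : #|porbit s x|%:R <= (m - k)%:R :> R by rewrite ler_nat.
  rewrite natrB //; lra.
apply: le_trans (ler_norm _).
have : c <= #|porbit s x :&: A|%:R / #|A|%:R by rewrite ler_pdivlMr.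
have : #|porbit s x|%:R / N%:R <= c - k%:R / N%:R.
  by rewrite ler_pdivrMr // mulrBl divfK ?gt_eqF.
by move: (_ / _) (_ / _) (_ / _) => *; lra.
Qed.

End LargestCycle.

(** * Covariance bound for a graph containing a path *)

Section PathBound.
Context {R : realType} {N : nat} (nu c : R) (E : {set {set 'I_N}}).
Hypothesis nu0 : 0 < nu.
Notation V := {ffun 'S_N -> R^o}.
Notation Q := (interchange_generator nu E).

Definition xi_fun : V := [ffun s => (xi c s)%:R].
Definition xi_trace_fun (A : {set 'I_N}) : V := [ffun s => (xi_trace c A s)%:R].
Definition one_fun : V := [ffun=> 1].

Lemma scale_one_fun (a : R) s : (a *: one_fun) s = a.
Proof. by rewrite !ffunE /GRing.scale /= mulr1. Qed.

Lemma dot_one_one : dot one_fun one_fun = N`!%:R.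
Proof.
rewrite /dot; under eq_bigr do rewrite ffunE mulr1.
by rewrite sumr_const; congr (_ *+ _); exact: card_Sn.
Qed.

Lemma coset_avg_one (H : {group 'S_N}) : coset_avg H one_fun = one_fun.
Proof.
apply/ffunP => s; rewrite [RHS]ffunE.
by apply: coset_avg_const => h _; rewrite ffunE.
Qed.

(** The average of the trace over the cosets of Sym A is a constant, so the
    average of the centred xi is, up to a constant, the average of xi minus its
    trace; being orthogonal to the constants, it is at most as long as that
    difference. *)
Lemma coset_avg_centered_xi (A : {set 'I_N}) (m : R) :
  dot (xi_fun - m *: one_fun) one_fun = 0 ->
  dot (coset_avg (Sym_group A) (xi_fun - m *: one_fun))
      (coset_avg (Sym_group A) (xi_fun - m *: one_fun)) <=
  #|[set s : 'S_N | xi c s != xi_trace c A s]%SET|%:R.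
Proof.
set P := coset_avg (Sym_group A); set f := _ - _ => f1.
pose D := xi_fun - xi_trace_fun A.
pose k : R := P (xi_trace_fun A) 1%g.
have Pk : P (xi_trace_fun A) = k *: one_fun.
  apply/ffunP => s; rewrite /P (coset_avg_trace (A := A)); last first.
    move=> {}s s' ss'; rewrite !ffunE; congr (_%:R); congr nat_of_bool.
    apply: eq_existsb => x; case: (boolP (x \in A)) => //= xA.
    rewrite (_ : porbit s x :&: A = porbit s' x :&: A) //.
    apply/setP => y; rewrite !inE; case: (boolP (y \in A)) => yA.
      by rewrite !andbT ss'.
    by rewrite !andbF.
  by rewrite scale_one_fun.
have PfE : P f = P D + (k - m) *: one_fun.
  have PB g h : P (g - h) = P g - P h.
    exact: (linearB (coset_avg (Sym_group A))).
  have PZ a g : P (a *: g) = a *: P g.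
    exact: (linearZZ (coset_avg (Sym_group A))).
  by rewrite /f /D !PB PZ {2}/P coset_avg_one Pk scalerBl addrA subrK.
have ortho : dot (P D) one_fun = - ((k - m) * N`!%:R).
  have : dot (P f) one_fun = 0 by rewrite coset_avg_sym coset_avg_one.
  by rewrite PfE dotDl dotZl dot_one_one => /eqP; rewrite addr_eq0 => /eqP.
(* D takes its values in {-1, 0, 1}. *)
have DD : dot D D = #|[set s : 'S_N | xi c s != xi_trace c A s]%SET|%:R.
  rewrite -sum1_card natr_sum [RHS]big_mkcond /=; apply: eq_bigr => s _.
  rewrite !ffunE inE; case: (xi c s); case: (xi_trace c A s) => /=; ring.
have S1 : dot D (P D) = dot (P D) (P D).
  by rewrite [RHS]coset_avg_sym coset_avg_idem.
rewrite -DD PfE; move: (dot_ge0 (D - P D)) S1 ortho; clearbody D.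
move: (P D) => PD.
rewrite !(dotDl, dotDr, dotNl, dotNr, dotZl, dotZr) dot_one_one.
rewrite (dotC one_fun) (dotC PD D) => H S1 ->.
rewrite S1 in H.
have : 0 <= (k - m) ^+ 2 * N`!%:R by rewrite mulr_ge0 ?sqr_ge0.
move: H; move: (dot _ _) (dot _ _) (k - m) (N`!%:R : R) => *; nra.
Qed.

Context (B : nat) (v : nat -> 'I_N).
Hypothesis vinj : forall i j, (i < B)%N -> (j < B)%N -> v i = v j -> i = j.
Hypothesis vE : forall i, (i.+1 < B)%N -> [set v i; v i.+1]%SET \in E.

Lemma covariance_path_bound (d : measure_display) (T : measurableType d)
    (Pr : probability T R) (X : R -> T -> 'S_N) (t : R) :
  markov_chain Q uniform_distribution Pr X -> 0 <= t ->
  exists2 u : R,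
    covariance Pr (fun w => (xi c (X 0 w))%:R) (fun w => (xi c (X t w))%:R) = u%:E &
    0 <= u <= #|[set s : 'S_N | xi c s != xi_trace c (path_set B v) s]%SET|%:R / N`!%:R
      + (1 + t * (nu / (2 * 40 ^+ B)))^-1.
Proof.
move=> mX t0.
have F0 : 0 < N`!%:R :> R by rewrite ltr0n fact_gt0.
have cE : #|{: 'S_N}| = N`! by rewrite card_Sn.
have := covariance_chain (fun s => (xi c s)%:R)
  (interchange_self_adjoint nu E) (interchange_const nu E) mX t0.
rewrite cE; set m := _ * _ => /= ->; eexists; first reflexivity.
pose f : V := xi_fun - m *: one_fun.
have fE s : f s = (xi c s)%:R - m by rewrite !ffunE /GRing.scale /= mulr1.
have f1 : dot f one_fun = 0.
  rewrite dotDl dotNl dotZl dot_one_one /m mulrAC mulVf ?gt_eqF // mul1r.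
  by apply/eqP; rewrite subr_eq0; apply/eqP/eq_bigr => s _; rewrite !ffunE mulr1.
have ff : dot f f <= N`!%:R.
  have -> : dot f f = dot f xi_fun.
    by rewrite {2}/f dotDr dotNr dotZr f1 mulr0 subr0.
  rewrite /f dotDl dotNl dotZl.
  have -> : dot one_fun xi_fun = m * N`!%:R.
    rewrite /m mulrAC mulVf ?gt_eqF // mul1r.
    by apply: eq_bigr => s _; rewrite !ffunE mul1r.
  have : dot xi_fun xi_fun <= N`!%:R.
    rewrite -dot_one_one; apply: ler_sum => s _; rewrite !ffunE mulr1.
    by case: (xi c s); rewrite ?mulr1 ?mulr0.
  have : 0 <= m * (m * N`!%:R) by rewrite mulrA mulr_ge0 -?expr2 ?sqr_ge0.
  move: (dot _ _) => a; lra.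
set H := Sym_group (path_set B v).
have HP h : h \in H -> perm_on (path_set B v) h by rewrite inE.
have ga0 : 0 <= nu / (2 * 40 ^+ B) by rewrite divr_ge0 ?mulr_ge0 ?exprn_ge0 // ltW.
have := heat_form_poincare (P := coset_avg H) (gamma := nu / (2 * 40 ^+ B)) (t := t) f
  (interchange_self_adjoint nu E) (interchange_form_le0 E nu0)
  (coset_avg_sym H) (coset_avg_idem H) ga0 t0
  (fun g => path_poincare nu0 vinj vE g HP).
have -> : \sum_x \sum_y (f x : R) * f y * transition_prob Q t x y =
    \sum_x \sum_y ((xi c x)%:R - m) * ((xi c y)%:R - m) * transition_prob Q t x y.
  by apply: eq_bigr => x _; apply: eq_bigr => y _; rewrite !fE.
move=> /andP[u0 u1]; rewrite mulr_ge0 //=.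
rewrite ler_pdivrMl // mulrDr mulrCA divff ?gt_eqF // mulr1.
apply: le_trans u1 _; apply: lerD; first exact: coset_avg_centered_xi.
by rewrite ler_wpM2r // invr_ge0 addr_ge0 // mulr_ge0.
Qed.

End PathBound.

(** * The torus *)

Section GraphLaplacian.
Context {R : realType} {N : nat} (nu : R) (E : {set {set 'I_N}}).
Implicit Types (psi : 'I_N -> R) (p q : 'I_N).

Lemma sum_edges_tperm psi p :
  \sum_(i < N) \sum_(j < N | (i < j)%N && ([set i; j]%SET \in E))
     (psi (tperm i j p) - psi p) =
  \sum_(q | (q != p) && ([set p; q]%SET \in E)) (psi q - psi p).
Proof.
rewrite [RHS](bigID (fun q : 'I_N => (p < q)%N)) /= (bigD1 p) //=; congr (_ + _).
  apply: eq_big => q; last by rewrite tpermL.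
  have [pq|_] := ltnP p q; last by rewrite andbF.
  by rewrite andbT (_ : q != p) // neq_ltn pq orbT.
rewrite [RHS]big_mkcond [LHS]big_mkcond /=; apply: eq_bigr => i _.
have [->|ip] := eqVneq i p; first by [].
rewrite /=; case: (boolP ((i < p)%N && ([set i; p]%SET \in E))).
  move=> ipE; rewrite (bigD1 p) //= tpermR big1 ?addr0 => [|j /andP[_ jp]].
    by case/andP: ipE => lt; rewrite finset.setUC => ->; rewrite -leqNgt ltnW.
  by rewrite tpermD ?subrr // eq_sym.
move=> ipE; rewrite big1 => [|j /andP[ij ijE]]; last first.
  have [jp|jp] := eqVneq j p; first by rewrite jp in ij ijE; rewrite ij ijE in ipE.
  by rewrite tpermD ?subrr // eq_sym.
case: ifP => // /andP[ipE' lt]; case/negP: ipE.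
by rewrite finset.setUC ipE' andbT ltn_neqAle ip leqNgt.
Qed.

(** A single card k performs a random walk on the graph, so an eigenfunction of
    the walk is one of the interchange process. *)
Lemma interchange_card_eigen psi (lam : R) (k : 'I_N) :
  (forall p, \sum_(q | (q != p) && ([set p; q]%SET \in E)) (psi q - psi p) =
             - lam * psi p) ->
  (- interchange_generator nu E) [ffun s : 'S_N => psi ((s^-1)%g k)] =
  (nu * lam) *: ([ffun s : 'S_N => psi ((s^-1)%g k)] : {ffun 'S_N -> R^o}).
Proof.
move=> lap; apply/ffunP => s.
rewrite opp_lfunE !ffunE lfunE ffunE /interchange_op /GRing.scale /=.
rewrite -mulrN -mulrA; congr (_ * _).
apply: (canLR (@opprK _)); rewrite -mulNr -lap -sum_edges_tperm.
apply: eq_bigr => i _; apply: eq_bigr => j _.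
by rewrite !ffunE invMg tpermV permM.
Qed.

End GraphLaplacian.

Section TorusGraph.
Context {R : realType} {d n : nat} (hd : (1 <= d)%N) (hn : (2 <= n)%N).
Context (lab : torus d n -> 'I_(n.+1 ^ d)) (labB : bijective lab).
Notation L := (n.+1).
Implicit Types (x y : {ffun 'I_d -> 'I_n.+1}).

Let j0 : 'I_d := Ordinal hd.

Lemma torus_adj_sym x y : torus_adj x y = torus_adj y x.
Proof.
rewrite /torus_adj eq_sym; congr (_ && _); apply: eq_existsb => j.
by rewrite -(opprB y x) eqr_opp eqr_oppLR orbC.
Qed.

Lemma torus_edgesE x y : ([set lab x; lab y]%SET \in torus_edges lab) = torus_adj x y.
Proof.
apply/imsetP/idP => [[[u1 u2]]|xy]; last by exists (x, y) => //; rewrite inE.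
rewrite inE /= => adj e.
have labI := bij_inj labB.
have xin : lab x \in [set lab u1; lab u2]%SET by rewrite -e !inE eqxx.
have yin : lab y \in [set lab u1; lab u2]%SET by rewrite -e !inE eqxx orbT.
have u1in : lab u1 \in [set lab x; lab y]%SET by rewrite e !inE eqxx.
have u2in : lab u2 \in [set lab x; lab y]%SET by rewrite e !inE eqxx orbT.
move: xin yin u1in u2in adj; rewrite !inE !(inj_eq labI).
have irr z : torus_adj z z = false by rewrite /torus_adj eqxx.
move=> /orP[] /eqP -> /orP[] /eqP -> //; rewrite ?irr //.
- by rewrite !orbb => _ /eqP ->; rewrite irr.
- by move=> _ _; rewrite torus_adj_sym.
- by rewrite !orbb => /eqP ->; rewrite irr.
Qed.

Lemma unit_vectorE (j : 'I_d) : unit_vector j0 j = if j == j0 then inZp 1 else 0 :> 'I_L.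
Proof. by rewrite ffunE. Qed.

Lemma inZp1_neq0 : inZp 1 != 0 :> 'I_L.
Proof. by apply/eqP => /(congr1 val) /=; rewrite modn_small //; lia. Qed.

Definition line_point (i : nat) : {ffun 'I_d -> 'I_L} :=
  [ffun j => if j == j0 then inZp i else 0].

Lemma line_point_inj i i' : (i < L)%N -> (i' < L)%N ->
  lab (line_point i) = lab (line_point i') -> i = i'.
Proof.
move=> iL i'L /(bij_inj labB) /ffunP/(_ j0); rewrite !ffunE eqxx.
by move=> /(congr1 val) /=; rewrite !modn_small.
Qed.

Lemma line_point_adj i : (i.+1 < L)%N ->
  [set lab (line_point i); lab (line_point i.+1)]%SET \in torus_edges lab.
Proof.
move=> iL; rewrite torus_edgesE torus_adj_sym; apply/andP; split.
  apply/eqP => e; have := @line_point_inj i.+1 i iL (ltnW iL).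
  by rewrite e => /(_ erefl); lia.
apply/existsP; exists j0; apply/orP; left; rewrite subr_eq; apply/eqP/ffunP => j.
rewrite !ffunE; case: eqP => _; last by rewrite addr0.
by apply: val_inj; rewrite /= modnDm add1n.
Qed.

(** Only the two neighbours along the first axis change the first coordinate;
    they are distinct since the side length is at least 3. *)
Lemma torus_sum_neighbours (phi : 'I_L -> R) x :
  \sum_(y | torus_adj x y) (phi (y j0) - phi (x j0)) =
  (phi (x j0 + inZp 1) - phi (x j0)) + (phi (x j0 - inZp 1) - phi (x j0)).
Proof.
have uv0 : unit_vector j0 != 0 :> {ffun 'I_d -> 'I_L}.
  apply/eqP => /ffunP/(_ j0); rewrite unit_vectorE eqxx ffunE => /eqP.
  by rewrite (negbTE inZp1_neq0).
have adj1 : torus_adj x (x + unit_vector j0).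
  apply/andP; split; first by rewrite -subr_eq0 opprD addNKr oppr_eq0.
  by apply/existsP; exists j0; rewrite opprD addNKr eqxx orbT.
have adj2 : torus_adj x (x - unit_vector j0).
  apply/andP; split; first by rewrite -subr_eq0 opprB addrC subrK.
  by apply/existsP; exists j0; rewrite opprB addrC subrK eqxx.
have ne : x - unit_vector j0 != x + unit_vector j0.
  rewrite (inj_eq (addrI x)); apply/eqP => /ffunP/(_ j0).
  rewrite !ffunE eqxx => /eqP; rewrite eq_sym -subr_eq0 opprK => /eqP/(congr1 val)/=.
  by rewrite !modn_small //; lia.
rewrite (bigD1 (x + unit_vector j0)) //= (bigD1 (x - unit_vector j0)) /=; last first.
  by rewrite adj2 ne.
rewrite big1 ?addr0 => [|y /andP[/andP[/andP[xy /existsP[j jP]] y1] y2]].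
  by rewrite !ffunE eqxx.
have [jj0|jj0] := eqVneq j j0.
  case/orP: jP; rewrite jj0 => /eqP e.
    by move: y2; rewrite -e subKr eqxx.
  by move: y1; rewrite -[unit_vector j0]opprK -e subKr eqxx.
suff -> : y j0 = x j0 by rewrite subrr.
apply/esym/eqP; rewrite -subr_eq0; apply/eqP.
transitivity ((x - y) j0); first by rewrite !ffunE.
by case/orP: jP => /eqP ->; rewrite !ffunE eq_sym (negbTE jj0) ?oppr0.
Qed.

Notation theta := ((pi *+ 2) / n.+1%:R : R).

Lemma periodic_mod (f : R -> R) (k : nat) : periodic f (pi *+ 2) ->
  f ((k %% L)%:R * theta) = f (k%:R * theta).
Proof.
move=> pf.
have -> : k%:R = (k %% L)%:R + (k %/ L)%:R * L%:R :> R.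
  by rewrite -natrM -natrD addnC -divn_eq.
have LT : L%:R * theta = pi *+ 2 by rewrite mulrC divfK // pnatr_eq0.
move: (theta) LT => th LT.
by rewrite mulrDl -mulrA LT [_ * (pi *+ 2)]mulr_natl periodicn.
Qed.

(** The addition formulas around a circle of n.+1 points; both functions have
    period 2 pi, so the reduction modulo n.+1 is harmless. *)
Lemma cos_torus_eigen (a : 'I_L) :
  cos (((a + inZp 1)%R : 'I_L)%:R * theta) + cos (((a - inZp 1)%R : 'I_L)%:R * theta) =
  2 * cos theta * cos (a%:R * theta).
Proof.
have [cP sP] := (@cosD2pi R, @sinD2pi R).
have step (f : R -> R) (b : 'I_L) : periodic f (pi *+ 2) ->
    f (((b + inZp 1)%R : 'I_L)%:R * theta) = f (b%:R * theta + theta).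
  move=> pf; have -> : ((b + inZp 1)%R : 'I_L) = ((b + 1) %% L)%N :> nat.
    by rewrite /= modnDmr.
  by rewrite periodic_mod // natrD mulrDl mul1r.
set b := a - inZp 1; have aE : a = b + inZp 1 by rewrite subrK.
rewrite step // cosD {1 2 3}aE !step //.
set u := b%:R * theta; have -> : cos u = cos (u + theta - theta) by rewrite addrK.
rewrite [cos (_ - theta)]cosB; ring.
Qed.

End TorusGraph.

(** * Relaxation time of the torus and choice of the parameters *)

Lemma torus_relaxation_time_ge (R : realType) (d n : nat) (nu : R)
    (lab : torus d n -> 'I_(n.+1 ^ d)) :
  (1 <= d)%N -> (2 <= n)%N -> 0 < nu -> bijective lab ->
  let lam := nu * (4 * sin (pi / n.+1%:R) ^+ 2) in
  0 < lam /\ lam^-1 <= relaxation_time (interchange_generator nu (torus_edges lab)).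
Proof.
move=> hd hn nu0 labB lam; have [g gK Kg] := labB.
set x : R := pi / n.+1%:R.
have n0 : 0 < n.+1%:R :> R by rewrite ltr0n.
have sx : 0 < sin x.
  apply: sin_gt0_pi; rewrite divr_gt0 ?pi_gt0 //= ltr_pdivrMr //.
  by rewrite ltr_pMr ?pi_gt0 // ltr1n; lia.
have lam0 : 0 < lam by rewrite /lam !mulr_gt0 // exprn_gt0.
split=> //; set theta : R := (pi *+ 2) / n.+1%:R.
have cx : 2 - 2 * cos theta = 4 * sin x ^+ 2.
  have -> : theta = x + x by rewrite /theta mulrnAl mulr2n.
  by rewrite cosD; have := cos2Dsin2 x; rewrite !expr2; lra.
pose j0 : 'I_d := Ordinal hd.
pose psi (p : 'I_(n.+1 ^ d)) : R := cos ((g p j0)%:R * theta).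
pose k0 := lab [ffun=> 0].
apply: (@relaxation_time_ge _ _ _ _ [ffun s : 'S_(n.+1 ^ d) => psi ((s^-1)%g k0)]).
- exact: interchange_self_adjoint.
- exact: lam0.
- apply/eqP => /ffunP/(_ 1%g); rewrite !ffunE invg1 perm1 /psi gK ffunE.
  by rewrite mul0r cos0 => /eqP; rewrite oner_eq0.
apply: interchange_card_eigen => p.
rewrite -[p]Kg; set u := g p.
rewrite (reindex lab) /=; last exact: onW_bij.
rewrite (eq_bigl (torus_adj u)) => [|y]; last first.
  rewrite torus_edgesE // (inj_eq (bij_inj labB)) eq_sym.
  by rewrite /torus_adj andbA andbb.
rewrite /psi gK; under eq_bigr do rewrite gK.
have := torus_sum_neighbours hd hn (fun a : 'I_n.+1 => cos (a%:R * theta)) u.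
move=> /= ->; have := cos_torus_eigen (R := R) (u j0); rewrite -/theta -cx.
move: (cos (_ * theta)) (cos (_ * theta)) (cos (_ * theta)) => *; lra.
Qed.

(** Take k about N / M with M large, which makes the window narrow compared with
    N, and then B of order M^2 / eps. *)
Lemma window_choice (R : realType) (c eps : R) : 0 < c -> c < 1 -> 0 < eps ->
  exists2 B : nat, (0 < B)%N & exists N1 : nat, forall N, (N1 <= N)%N ->
  exists m k : nat, [/\ (0 < k)%N, (k <= m)%N, (m + k < N)%N &
    [/\ m%:R <= c * N%:R, c * N%:R < m.+1%:R &
    N%:R ^+ 2 / (B%:R * k%:R ^+ 2) +
    N%:R * (2 * k%:R) / ((m - k).+1%:R * (N - (m + k))%:R) <= eps]].
Proof.
move=> c0 c1 e0; set K : R := 16 / (eps * c * (1 - c)) + 2 / c + 2 / (1 - c).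
have c1' : 0 < 1 - c by rewrite subr_gt0.
have t1 : 0 < 16 / (eps * c * (1 - c)) by rewrite divr_gt0 ?mulr_gt0.
have t2 : 0 < 2 / c by rewrite divr_gt0.
have t3 : 0 < 2 / (1 - c) by rewrite divr_gt0.
have K0 : 0 < K by rewrite /K; lra.
pose M := Num.bound K; have MK : K < M%:R by apply: archi_boundP; exact: ltW.
have M0 : 0 < M%:R :> R by apply: lt_trans MK.
have Mn : (0 < M)%N by rewrite -(ltr0n R).
have M1 : 16 <= eps * c * (1 - c) * M%:R.
  by rewrite mulrC -ler_pdivrMr ?mulr_gt0 //; move: MK; rewrite /K; lra.
have M2 : 2 <= c * M%:R.
  by rewrite mulrC -ler_pdivrMr //; move: MK; rewrite /K; lra.
have M3 : 2 <= (1 - c) * M%:R.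
  by rewrite mulrC -ler_pdivrMr //; move: MK; rewrite /K; lra.
pose B := (Num.bound (8 * M%:R ^+ 2 / eps)).+1.
have BK : 8 * M%:R ^+ 2 <= B%:R * eps.
  rewrite -ler_pdivrMr //; apply: (@le_trans _ _ (Num.bound (8 * M%:R ^+ 2 / eps))%:R).
    by apply/ltW/archi_boundP; rewrite divr_ge0 ?mulr_ge0 ?exprn_ge0 // ltW.
  by rewrite ler_nat.
have B0 : 0 < B%:R :> R by rewrite ltr0n.
clearbody B M; move: K0 MK t1 t2 t3 => _ _ _ _ _; clear K.
exists B; first by rewrite -(ltr0n R).
exists (2 * M)%N => N NM.
pose k := (N %/ M)%N.
have kM : (k * M <= N)%N by apply: leq_trunc_div.
have kM' : (N < k.+1 * M)%N by rewrite ltn_ceil.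
have k0 : (0 < k)%N by rewrite divn_gt0 //; move: NM; clear; lia.
have k2 : (N <= 2 * k * M)%N by move: kM' k0; clear; nia.
clearbody k.
have N0 : 0 < N%:R :> R by rewrite ltr0n; move: NM Mn; clear; lia.
have /andP[mc cm] : (Num.trunc (c * N%:R))%:R <= c * N%:R < (Num.trunc (c * N%:R)).+1%:R.
  by apply: trunc_itv; rewrite mulr_ge0 // ltW.
move: (Num.trunc _) mc cm => m mc cm.
have kR0 : 0 < k%:R :> R by rewrite ltr0n.
have kMR : k%:R * M%:R <= N%:R :> R by rewrite -natrM ler_nat.
have k2R : N%:R <= 2 * k%:R * M%:R :> R by rewrite -!natrM ler_nat.
have kc : 2 * k%:R <= c * N%:R.
  apply: (@le_trans _ _ (c * (k%:R * M%:R))); last by rewrite ler_pM2l.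
  by rewrite mulrCA mulrC ler_pM2l.
have kc' : 2 * k%:R <= (1 - c) * N%:R.
  apply: (@le_trans _ _ ((1 - c) * (k%:R * M%:R))); last by rewrite ler_pM2l.
  by rewrite mulrCA mulrC ler_pM2l.
have cN0 : 0 < c * N%:R by rewrite mulr_gt0.
have km : (k <= m)%N by rewrite -ltnS -(ltr_nat R); move: kc cm kR0; clear; lra.
have mkN : (m + k < N)%N.
  by rewrite -(ltr_nat R) natrD; move: kc' mc kR0; clear; lra.
exists m, k; split => //; split => //.
have F1 : N%:R ^+ 2 / (B%:R * k%:R ^+ 2) <= eps / 2.
  rewrite ler_pdivrMr ?mulr_gt0 ?exprn_gt0 //.
  apply: (@le_trans _ _ ((2 * k%:R * M%:R) ^+ 2)).
    by rewrite lerXn2r ?nnegrE ?mulr_ge0 // ltW.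
  have -> : (2 * k%:R * M%:R) ^+ 2 = (8 * M%:R ^+ 2) * (k%:R ^+ 2 / 2) :> R.
    by field.
  have -> : eps / 2 * (B%:R * k%:R ^+ 2) = (B%:R * eps) * (k%:R ^+ 2 / 2).
    by field.
  by rewrite ler_pM2r // divr_gt0 // exprn_gt0.
have F2 : N%:R * (2 * k%:R) / ((m - k).+1%:R * (N - (m + k))%:R) <= eps / 2.
  have d1 : c * N%:R / 2 <= (m - k).+1%:R.
    by rewrite -(natr1 (m - k)) natrB //; move: kc cm; rewrite -(natr1 m); clear; lra.
  have d2 : (1 - c) * N%:R / 2 <= (N - (m + k))%:R.
    by rewrite natrB ?natrD 1?ltnW //; move: kc' mc; clear; lra.
  have p1 : 0 < c * N%:R / 2 by rewrite divr_gt0.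
  have p2 : 0 < (1 - c) * N%:R / 2 by rewrite divr_gt0 ?mulr_gt0.
  rewrite ler_pdivrMr; last first.
    by apply: mulr_gt0; [exact: lt_le_trans p1 d1|exact: lt_le_trans p2 d2].
  apply: (@le_trans _ _ (eps / 2 * ((c * N%:R / 2) * ((1 - c) * N%:R / 2)))); last first.
    by rewrite ler_pM2l ?divr_gt0 //; apply: ler_pM => //; exact: ltW.
  have -> : eps / 2 * (c * N%:R / 2 * ((1 - c) * N%:R / 2)) =
      N%:R * (eps * c * (1 - c) * N%:R / 8) by field.
  rewrite ler_pM2l // ler_pdivlMr //.
  apply: (@le_trans _ _ (eps * c * (1 - c) * (k%:R * M%:R))); last first.
    by rewrite ler_pM2l ?mulr_gt0.
  rewrite mulrCA; apply: (@le_trans _ _ (k%:R * 16)); last by rewrite ler_pM2l.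
  by rewrite (_ : 2 * k%:R * 8 = k%:R * 16) //; ring.
by rewrite [leRHS](splitr eps); apply: lerD.
Qed.

(** * Noise sensitivity *)

Lemma torus_gap_cvg0 (R : realType) (nu : R) :
  (fun n : nat => nu * (4 * sin (pi / n.+1%:R) ^+ 2)) @ \oo --> (0 : R).
Proof.
have h : (fun n : nat => pi / n.+1%:R : R) @ \oo --> (0 : R).
  rewrite -[X in _ --> X](mulr0 pi).
  by apply: cvgMl_tmp; exact: cvg_harmonic.
have s : (fun n : nat => sin (pi / n.+1%:R) : R) @ \oo --> (0 : R).
  rewrite -[X in _ --> X]sin0.
  by apply: (cvg_comp _ _ h); exact: continuous_sin.
rewrite -[X in _ --> X](mulr0 nu); apply: cvgMl_tmp.
rewrite -[X in _ --> X](mulr0 4); apply: cvgMl_tmp.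
rewrite -[X in _ --> X](mulr0 0); under eq_fun do rewrite expr2.
exact: cvgM.
Qed.

(* The index n stands for side length n.+1, which ranges over n >= 1. *)
Theorem corollary1p5 (R : realType) (c : R) (d : nat) (nu : R)
    (lab : forall n : nat, torus d n -> 'I_(n.+1 ^ d))
    (hc0 : 0 < c) (hc1 : c < 1) (hd : (1 <= d)%N) (hnu : 0 < nu)
    (hlab : forall n : nat, bijective (lab n)) :
  @noise_sensitive R (fun n : nat => 'S_(n.+1 ^ d))
    (fun n : nat => interchange_generator nu (torus_edges (lab n)))
    (fun n : nat => uniform_distribution)
    (fun n : nat => @xi R c (n.+1 ^ d)).
Proof.
move=> disp T P X mX alpha alpha0.
set cov := fun n => covariance _ _ _.
suff main (eps : R) : 0 < eps ->
    \forall n \near \oo, exists2 u : R, cov n = u%:E & `|u| <= eps.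
  apply: cvg_EFin.
    near=> n; have [u -> _] // : exists2 u : R, cov n = u%:E & `|u| <= 1.
    by near: n; apply: main.
  apply/cvgr0Pnorm_le => eps eps0; near=> n => /=.
  have [u -> ?] // : exists2 u : R, cov n = u%:E & `|u| <= eps.
  by near: n; apply: main.
move=> eps0; have e20 : 0 < eps / 2 by rewrite divr_gt0.
have [B B0 [N1 NP]] := window_choice hc0 hc1 e20.
pose gamma : R := nu / (2 * 40 ^+ B).
have ga0 : 0 < gamma by rewrite divr_gt0 // mulr_gt0 // exprn_gt0.
have tau0 : 0 < eps / 2 * (alpha * gamma) by rewrite !mulr_gt0.
near=> n.
have n2 : (2 <= n)%N by near: n; exact: nbhs_infty_ge.
have nB : (B <= n)%N by near: n; exact: nbhs_infty_ge.
have nN1 : (N1 <= n)%N by near: n; exact: nbhs_infty_ge.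
have lam_small : nu * (4 * sin (pi / n.+1%:R) ^+ 2) <= eps / 2 * (alpha * gamma).
  apply: le_trans (ler_norm _) _; near: n.
  by have /cvgr0Pnorm_le/(_ _ tau0) := torus_gap_cvg0 nu.
have [lam0] := torus_relaxation_time_ge hd n2 hnu (hlab n).
move: lam_small; set lam := nu * _; set trel := relaxation_time _.
move=> lam_small lamt.
have t0 : 0 < trel by apply: lt_le_trans lamt; rewrite invr_gt0.
have BL i : (i < B)%N -> (i < n.+1)%N.
  by move=> h; apply: leq_trans h _; apply: leq_trans nB _.
pose v i := lab n (line_point hd i).
have vinj i j : (i < B)%N -> (j < B)%N -> v i = v j -> i = j.
  by move=> /BL iB /BL jB; apply: (line_point_inj (hlab n)).
have vE i : (i.+1 < B)%N -> [set v i; v i.+1]%SET \in torus_edges (lab n).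
  by move=> /BL iB; apply: line_point_adj.
have ta0 : 0 <= alpha * trel by rewrite mulr_ge0 // ltW.
have [u covE /andP[u0 u1]] := covariance_path_bound c hnu vinj vE (mX n) ta0.
exists u; first exact: covE.
rewrite ger0_norm //; apply: le_trans u1 _; rewrite [leRHS](splitr eps); apply: lerD.
  have NN : (N1 <= n.+1 ^ d)%N.
    apply: leq_trans nN1 (leq_trans (leqnSn n) _).
    by rewrite -{1}(expn1 n.+1) leq_pexp2l.
  have [m [k [k0 km mkN [mc cm bd]]]] := NP _ NN.
  have F0 : 0 < (n.+1 ^ d)`!%:R :> R by rewrite ltr0n fact_gt0.
  have cA := card_path_set vinj.
  have A0 : (0 < #|path_set B v|)%N by rewrite cA.
  rewrite ler_pdivrMr // mulrC.
  apply: le_trans (xi_trace_approx hc0 A0 k0 km mkN mc cm) _.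
  by rewrite cA ler_pM2l //; exact: bd.
apply: (@le_trans _ _ (alpha * trel * gamma)^-1).
  rewrite lef_pV2 ?posrE ?ltr_wpDl ?mulr_gt0 //.
    by rewrite lerDr.
rewrite -div1r ler_pdivrMr ?mulr_gt0 //.
apply: (@le_trans _ _ (lam * trel)); first by rewrite -ler_pdivrMl // mulr1.
have -> : eps / 2 * (alpha * trel * gamma) = eps / 2 * (alpha * gamma) * trel by ring.
by rewrite ler_pM2r.
Unshelve. all: by end_near. Qed.
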